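(* Let $\Gamma$ be a countably infinite amenable group and let $(L,\lambda)$ be a nontrivial standard probability space. Then the Bernoulli shift $\Gamma\curvearrowright(L^\Gamma,\lambda^\Gamma)$ satisfies $$\operatorname{mult}_{L^1}(\Gamma\curvearrowright L^\Gamma)=\operatorname{mult}_{L^1_0}(\Gamma\curvearrowright L^\Gamma)=\infty .$$
   Context: The Bernoulli shift over $\Gamma$ with base $(L,\lambda)$ is the product probability space $(L^\Gamma,\lambda^\Gamma)$ with the action $(\gamma\cdot\omega)_g=\omega_{\gamma^{-1}g}$ for $\gamma,g\in\Gamma$. The base is nontrivial if $\lambda$ is not concentrated on a single point. For a measure-preserving action of a countable group $\Gamma$ on a standard probability space $(X,\mathcal B,\mu)$, the Koopman isometries on complex $L^1(X)=L^1(X,\mu;\mathbb C)$ are $U_\gamma f=f\circ\gamma^{-1}$. For $f_1,\dots,f_m\in L^1(X;\mathbb C)$ put $$G_\Gamma(f_1,\dots,f_m):=\overline{\operatorname{span}_{\mathbb C}\{U_\gamma f_s:\gamma\in\Gamma,\ 1\le s\le m\}}^{\,L^1}.$$ The $L^1$-orbit multiplicity is $$\operatorname{mult}_{L^1}(\Gamma\curvearrowright X):=\inf\{m\ge1: G_\Gamma(f_1,\dots,f_m)=L^1(X)\text{ for some }f_1,\dots,f_m\in L^1(X;\mathbb C)\},$$ with value $\infty$ if no such finite family exists. With $L^1_0(X):=\{f\in L^1(X):\int_X f\,d\mu=0\}$, the $L^1_0$-orbit multiplicity $\operatorname{mult}_{L^1_0}(\Gamma\curvearrowright X)$ is the infimum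 of $m\ge1$ such that $G_\Gamma(f_1,\dots,f_m)=L^1_0(X)$ for some $f_1,\dots,f_m\in L^1_0(X)$, and $\infty$ if there is no such $m$. *)

(* Defs.v *)
From HB Require Import structures.
From mathcomp Require Import all_boot all_order all_algebra.
From mathcomp Require Import finmap complex.
From mathcomp Require Import all_classical all_reals all_analysis.

Set Implicit Arguments.
Unset Strict Implicit.
Unset Printing Implicit Defensive.

Import Order.TTheory GRing.Theory Num.Theory.
Import numFieldNormedType.Exports.

Local Open Scope classical_set_scope.
Local Open Scope ring_scope.

(* A countable discrete group is amenable if it has a (left) Folner sequence:
   nonempty finite sets F_n with |g F_n /_\ F_n| / |F_n| --> 0 for every g. *)
Definition amenable (R : realType) (Gam : groupType) : Prop :=
  exists F : nat -> {fset Gam},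
    (forall n, F n != fset0) /\
    (forall g : Gam,
      let gF n := [fset (g * x)%g | x in F n]%fset in
      (fun n => #|` ((gF n `\` F n) `|` (F n `\` gF n))%fset|%:R
                  / #|` F n|%:R : R) @ \oo --> (0 : R)).

(* Standard Borel: isomorphic, as a measurable space, to a separable complete
   metric space T with its Borel sigma-algebra. *)
Definition standard_borel (R : realType) d (L : measurableType d) : Prop :=
  exists (T : completePseudoMetricType R) (phi : L -> T),
    [/\ hausdorff_space T,
        exists2 D : set T, countable D & dense D,
        bijective phi
      & forall A : set L, measurable A <-> <<s @open T >> (phi @` A)].

Definition concentrated_on_point (R : realType) d (L : measurableType d)
    (lambda : probability L R) : Prop :=
  exists x : L, lambda (~` [set x]) = 0%E.

Definition coordinate_sets (Gam : Type) d (L : measurableType d) :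
    set (set (Gam -> L)) :=
  [set C | exists g (A : set L), measurable A /\ C = [set w | A (w g)]].

(* L^Gam with the product sigma-algebra. *)
Notation shift_space Gam L := (g_sigma_algebraType (@coordinate_sets Gam _ L)).

(* mu = lambda^Gam: the values on finite-dimensional boxes generate the product
   sigma-algebra and are stable under intersection, hence determine mu. *)
Definition is_product_measure (R : realType) (Gam : groupType)
    d (L : measurableType d) (lambda : probability L R)
    (mu : probability (shift_space Gam L) R) : Prop :=
  forall (F : {fset Gam}) (A : Gam -> set L),
    (forall g, measurable (A g)) ->
    mu [set w : Gam -> L | forall g, g \in F -> A g (w g)] =
    \big[*%E/1%E]_(g <- F) lambda (A g).

Definition bernoulli_shift (Gam : groupType) d (L : measurableType d)
    (gam : Gam) (w : shift_space Gam L) : shift_space Gam L :=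
  fun g => w (gam^-1 * g)%g.

Section OrbitMultiplicity.
Context (R : realType) d (X : measurableType d) (mu : probability X R).

(* Elements of L^1(X; C) are represented by functions. L1, L10 and
   closed_orbit_span are saturated for a.e. equality among measurable functions,
   so equality of these sets is equality of the subspaces of L^1. *)
Definition L1norm (f : X -> R[i]) : \bar R :=
  (\int[mu]_x (Normc.normc (f x))%:E)%E.

Definition L1 : set (X -> R[i]) :=
  [set f | [/\ measurable_fun setT (fun x => complex.Re (f x)),
               measurable_fun setT (fun x => complex.Im (f x))
             & (L1norm f < +oo)%E]].

Definition cintegral (f : X -> R[i]) : R[i] :=
  Complex (\int[mu]_x complex.Re (f x))%R (\int[mu]_x complex.Im (f x))%R.

Definition L10 : set (X -> R[i]) := [set f | L1 f /\ cintegral f = 0].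

Context (Gam : groupType) (act : Gam -> X -> X).

Definition koopman (gam : Gam) (f : X -> R[i]) : X -> R[i] :=
  fun x => f (act (gam^-1)%g x).

Definition orbit_span m (f : 'I_m -> X -> R[i]) : set (X -> R[i]) :=
  [set h | exists s : seq (R[i] * Gam * 'I_m),
     h = fun x => \sum_(t <- s) t.1.1 * koopman t.1.2 (f t.2) x].

Definition closed_orbit_span m (f : 'I_m -> X -> R[i]) : set (X -> R[i]) :=
  [set g | L1 g /\ forall e : R, 0 < e ->
     exists2 h, orbit_span f h & (L1norm (fun x => (g x - h x)%R) < e%:E)%E].

(* Multiplicities take values in {1, 2, ...} U {+oo}; ereal_inf set0 = +oo. *)
Definition orbit_mult (V : set (X -> R[i])) : \bar R :=
  ereal_inf [set (m%:R)%:E | m in [set m : nat | (1 <= m)%N /\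
    exists f : 'I_m -> X -> R[i],
      (forall s, V (f s)) /\ closed_orbit_span f = V]].

Definition mult_L1 : \bar R := orbit_mult L1.
Definition mult_L10 : \bar R := orbit_mult L10.

End OrbitMultiplicity.

(* Main.v *)
From HB Require Import structures.
Require Import Defs.
From mathcomp Require Import all_boot all_order all_algebra.
From mathcomp Require Import finmap complex.
From mathcomp Require Import all_classical all_reals all_analysis.
From mathcomp Require Import measurable_realfun.
From mathcomp Require Import ring lra zify.

(** The key is a rigidity phenomenon: a bounded orthonormal system
    [v_1, ..., v_N], each [v_i] a function of boundedly many independent bits
    and each bit entering boundedly many [v_i], cannot be approximated in [L^1]
    within a small constant by a subspace of dimension at most [N / 2]. Indeed,
    if it can, then for many points [x] the vector [v(x)] in [R^N] is uniformly
    close to a fixed subspace [W] of dimension at most [N / 2], up to a small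
    set [J] of exceptional coordinates. There are only [exp(o(N))] choices of
    [J], so one of them works on an event of probability at least
    [exp(- o(N))]. By concentration of measure a typical point differs from that
    event in few bits, hence [v(x)] is typically [o(sqrt N)]-close in [l^2] to a
    subspace of codimension at least [N / 4]. Orthonormality makes the mean
    square distance to any subspace at least its codimension, a contradiction.

    Fix [A] with [0 < lambda A < 1], let [phi] be the centred and normalized
    indicator of [A] and let [h_j] be the product of [phi (w_g)] over [g] in a
    finite set [S_j], for [8 m] sets [S_j] whose translates are pairwise
    distinct. The translates of the [h_j] by a finite set [F] form an
    orthonormal system of the above kind with [8 m |F|] members. If [m]
    functions generated, each [h_j] would be close in [L^1] to a combination of
    their translates by a finite set [K], independent of [F], and so the system
    would be close to a real space of dimension at most [2 m |K F|], which is at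
    most [4 m |F|] for a suitable Folner set [F]. *)

Set Implicit Arguments.
Unset Strict Implicit.
Unset Printing Implicit Defensive.

Import Order.TTheory GRing.Theory Num.Theory.
Import numFieldNormedType.Exports.

Local Open Scope ring_scope.

(** * Concentration on the Bernoulli cube *)

Section BernoulliCube.
Context (R : realType) (T : finType) (q : bool -> R).
Context (q_ge0 : forall c, 0 <= q c) (q_sum : \sum_c q c = 1).

Definition cube_weight (b : {ffun T -> bool}) : R := \prod_t q (b t).

Definition cube_mean (f : {ffun T -> bool} -> R) : R :=
  \sum_b cube_weight b * f b.

Definition cube_prob (A : {set {ffun T -> bool}}) : R :=
  \sum_(b in A) cube_weight b.

Definition set_bit (b : {ffun T -> bool}) t c : {ffun T -> bool} :=
  [ffun u => if u == t then c else b u].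

(** Conditional expectation given all bits other than [t]. *)
Definition bit_mean t (f : {ffun T -> bool} -> R) b : R :=
  \sum_c q c * f (set_bit b t c).

Definition hamming (a b : {ffun T -> bool}) : nat := #|[set t | a t != b t]|.

Lemma cube_weight_ge0 b : 0 <= cube_weight b.
Proof. by apply: prodr_ge0. Qed.

(** Independence of the bits: distributing the product over the sums yields one term for each
    [b]. *)
Lemma cube_mean_prod (g : T -> bool -> R) :
  cube_mean (fun b => \prod_t g t (b t)) = \prod_t \sum_c q c * g t c.
Proof.
rewrite bigA_distr_bigA; apply: eq_bigr => b _.
by rewrite -big_split.
Qed.

Lemma cube_weight_sum : \sum_b cube_weight b = 1.
Proof.
have := cube_mean_prod (fun _ _ => 1); rewrite /cube_mean /=.
under eq_bigr do rewrite big1_eq mulr1.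
by move=> ->; rewrite big1 // => t _; under eq_bigr do rewrite mulr1.
Qed.

Lemma cube_mean_cst k : cube_mean (fun=> k) = k.
Proof. by rewrite /cube_mean -mulr_suml cube_weight_sum mul1r. Qed.

Lemma le_cube_mean f g : (forall b, f b <= g b) -> cube_mean f <= cube_mean g.
Proof.
move=> fg; apply: ler_sum => b _.
by rewrite ler_wpM2l // cube_weight_ge0.
Qed.

Lemma cube_meanZ k f : cube_mean (fun b => k * f b) = k * cube_mean f.
Proof.
by rewrite /cube_mean mulr_sumr; apply: eq_bigr => b _; rewrite mulrCA.
Qed.

Lemma cube_meanD f g :
  cube_mean (fun b => f b + g b) = cube_mean f + cube_mean g.
Proof. by rewrite -big_split; apply: eq_bigr => b _; rewrite mulrDr. Qed.

Lemma cube_mean_sum (I : finType) (P : pred I)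
    (f : I -> {ffun T -> bool} -> R) :
  cube_mean (fun b => \sum_(i | P i) f i b) = \sum_(i | P i) cube_mean (f i).
Proof.
rewrite /cube_mean exchange_big; apply: eq_bigr => b _.
by rewrite mulr_sumr.
Qed.

Lemma cube_prob_le_mean (A : {set {ffun T -> bool}}) f :
  (forall b, 0 <= f b) -> (forall b, b \in A -> 1 <= f b) ->
  cube_prob A <= cube_mean f.
Proof.
move=> f0 f1; rewrite /cube_prob big_mkcond; apply: ler_sum => b _.
case: ifPn => [bA|_]; last by rewrite mulr_ge0 ?cube_weight_ge0.
by rewrite ler_peMr ?cube_weight_ge0 ?f1.
Qed.

Lemma set_bitK b t c : set_bit (set_bit b t c) t (b t) = b.
Proof. by apply/ffunP => u; rewrite !ffunE; case: eqP => // ->. Qed.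

Lemma set_bit_set_bit b t c e : set_bit (set_bit b t c) t e = set_bit b t e.
Proof. by apply/ffunP => u; rewrite !ffunE; case: eqP. Qed.

Lemma set_bitC b t c u e : t != u ->
  set_bit (set_bit b t c) u e = set_bit (set_bit b u e) t c.
Proof.
move=> tu; apply/ffunP => w; rewrite !ffunE.
by case: (eqVneq w u) => [->|//]; rewrite eq_sym (negbTE tu).
Qed.

Lemma set_bitE b t c : set_bit b t c t = c.
Proof. by rewrite ffunE eqxx. Qed.

(** In product form, so that [q (b t)] may vanish. *)
Lemma cube_weight_set_bit b t c :
  cube_weight (set_bit b t c) * q (b t) = cube_weight b * q c.
Proof.
rewrite /cube_weight (bigD1 t) //= [in RHS](bigD1 t) //= set_bitE.
have -> : \prod_(i | i != t) q (set_bit b t c i) = \prod_(i | i != t) q (b i).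
  by apply: eq_bigr => u ut; rewrite ffunE (negbTE ut).
by ring.
Qed.

(* Swapping the old and the new value of the bit is a weight-preserving
   involution of pairs. *)
Lemma cube_mean_bit_mean t f : cube_mean (bit_mean t f) = cube_mean f.
Proof.
rewrite /cube_mean /bit_mean.
under eq_bigr do rewrite mulr_sumr.
rewrite pair_bigA /=.
pose h (p : {ffun T -> bool} * bool) := (set_bit p.1 t p.2, p.1 t).
have hK : involutive h.
  by case=> b c; rewrite /h /= set_bitK set_bitE.
rewrite (reindex_inj (inv_inj hK)) /=.
transitivity (\sum_(p : {ffun T -> bool} * bool) cube_weight p.1 * q p.2 * f p.1).
  apply: eq_bigr => -[b c] _ /=.
  by rewrite set_bitK mulrA cube_weight_set_bit.
rewrite -(pair_bigA _ (fun b c => cube_weight b * q c * f b)) /=.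
apply: eq_bigr => b _.
by rewrite -mulr_suml -mulr_sumr q_sum mulr1.
Qed.

Definition bit_lipschitz (f : {ffun T -> bool} -> R) :=
  forall b t c, `|f b - f (set_bit b t c)| <= 1.

Lemma bit_lipschitz_bit_mean t f :
  bit_lipschitz f -> bit_lipschitz (bit_mean t f).
Proof.
move=> lf b u c; rewrite /bit_mean -sumrB.
apply: (le_trans (ler_norm_sum _ _ _)).
rewrite -[leRHS]q_sum; apply: ler_sum => e _.
rewrite -mulrBr normrM (ger0_norm (q_ge0 e)) ler_piMr //.
have [->|ut] := eqVneq u t.
  by rewrite set_bit_set_bit subrr normr0 ler01.
by rewrite set_bitC //; exact: lf.
Qed.

(** Averaging the bits out one at a time runs through the Doob martingale of [f]. *)
Definition bits_mean (s : seq T) f := foldl (fun g t => bit_mean t g) f s.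

(** Averaging over a further bit preserves independence of [t], so a bit stays irrelevant once it
    has been averaged out. *)
Lemma bits_mean_set_bit s f b t c :
  t \in s \/ (forall b c, f (set_bit b t c) = f b) ->
  bits_mean s f (set_bit b t c) = bits_mean s f b.
Proof.
elim: s f => [|u s IH] f; first by case.
move=> tus; apply: IH; rewrite -/(bits_mean _ _).
have [->|tu] := eqVneq t u.
  right=> b' c'; rewrite /bit_mean; apply: eq_bigr => e _.
  by rewrite set_bit_set_bit.
case: tus => [|finv]; first by rewrite inE (negbTE tu) /=; left.
right=> b' c'; rewrite /bit_mean; apply: eq_bigr => e _.
by rewrite set_bitC // finv.
Qed.

Lemma cube_invariant_cst (g : {ffun T -> bool} -> R) :
  (forall b t c, g (set_bit b t c) = g b) -> forall b b', g b = g b'.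
Proof.
move=> ginv b b'.
(* [s] lists the bits in which [b] may still differ from [b']; they are corrected one by one. *)
suff H (s : seq T) : forall b : {ffun T -> bool},
    (forall t, t \notin s -> b t = b' t) -> g b = g b'.
  by apply: (H (enum T)) => t; rewrite mem_enum.
elim: s => [|t s IH] {}b bb'.
  by congr g; apply/ffunP => t; exact: bb'.
rewrite -(ginv b t (b' t)); apply: IH => u us.
rewrite ffunE; case: eqVneq => [->//|ut].
by rewrite bb' // inE negb_or ut.
Qed.

(** From [1 - z <= expR (- z)] one gets [expR z <= (1 - z)^-1], and the claimed bound times [1 - z]
    is [1 + z ^+ 2 * (1 - 2 * z) >= 1]. *)
Lemma expR_le_quadratic (z : R) : `|z| <= 2^-1 -> expR z <= 1 + z + 2 * z ^+ 2.
Proof.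
rewrite ler_norml => /andP[z1 z2].
have h : 1 - z <= expR (- z) by have := expR_ge1Dx (- z).
have zp : 0 < 1 - z by lra.
have : expR z <= (1 - z)^-1.
  rewrite -[expR z]invrK -expRN lef_pV2 // posrE ?expR_gt0 //.
move=> /le_trans; apply.
rewrite -[(1 - z)^-1]mul1r ler_pdivrMr //.
have -> : (1 + z + 2 * z ^+ 2) * (1 - z) = 1 + z ^+ 2 * (1 - 2 * z) by ring.
by rewrite lerDl mulr_ge0 ?sqr_ge0 //; lra.
Qed.

(** Hoeffding's lemma with a weaker constant: after centring at the mean, the linear term of the
    exponential averages to zero and only the quadratic one remains. *)
Lemma two_point_hoeffding (y : bool -> R) (r : R) : 0 <= r -> r <= 2^-1 ->
  `|y true - y false| <= r ->
  \sum_c q c * expR (- y c) <=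
  expR (- (\sum_c q c * y c) + 2 * r ^+ 2).
Proof.
move=> r0 r1 ly; set m := \sum_c q c * y c.
have mE : m = q true * y true + q false * y false by rewrite /m big_bool.
have qE : q false = 1 - q true by move: q_sum; rewrite big_bool /= => <-; ring.
have q1 := q_ge0 true; have q2 := q_ge0 false.
have dev c : `|m - y c| <= r.
  rewrite mE; case: c.
  - have -> : q true * y true + q false * y false - y true =
              q false * - (y true - y false) by rewrite qE; ring.
    rewrite normrM normrN (ger0_norm q2); apply: le_trans ly.
    by rewrite ler_piMl //; lra.
  - have -> : q true * y true + q false * y false - y false =
              q true * (y true - y false) by rewrite qE; ring.
    rewrite normrM (ger0_norm q1); apply: le_trans ly.
    by rewrite ler_piMl //; lra.
have -> : \sum_c q c * expR (- y c) =
          expR (- m) * \sum_c q c * expR (m - y c).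
  rewrite mulr_sumr; apply: eq_bigr => c _.
  by rewrite mulrCA -expRD addrA addNr add0r.
rewrite expRD ler_wpM2l ?expR_ge0 //.
apply: (@le_trans _ _ (1 + 2 * r ^+ 2)); last by have := expR_ge1Dx (2 * r ^+ 2).
apply: (@le_trans _ _ (\sum_c (q c * (1 + 2 * r ^+ 2) + q c * (m - y c)))).
  apply: ler_sum => c _; rewrite -mulrDr ler_wpM2l //.
  apply: (le_trans (expR_le_quadratic _)).
    exact: le_trans (dev c) r1.
  rewrite -addrA [z in _ <= z]addrC addrA addrC.
  suff : (m - y c) ^+ 2 <= r ^+ 2 by lra.
  by rewrite -real_normK ?num_real // lerXn2r // nnegrE.
rewrite big_split -mulr_suml q_sum mul1r gerDl.
by rewrite big_bool /= mE qE; lra.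
Qed.

(** By the two-point bound each averaging costs a factor [expR (2 * r ^+ 2)], and it keeps the
    function Lipschitz. *)
Lemma bits_mean_expR_le (s : seq T) f (r : R) : 0 <= r -> r <= 2^-1 ->
  bit_lipschitz f ->
  cube_mean (fun b => expR (- (r * f b))) <=
  expR (2 * r ^+ 2 *+ size s) *
  cube_mean (fun b => expR (- (r * bits_mean s f b))).
Proof.
move=> r0 r1; elim: s f => [|t s IH] f lf; first by rewrite mulr0n expR0 mul1r.
rewrite -(cube_mean_bit_mean t).
apply: (@le_trans _ _ (expR (2 * r ^+ 2) *
    cube_mean (fun b => expR (- (r * bit_mean t f b))))).
  rewrite -cube_meanZ; apply: le_cube_mean => b; rewrite -expRD addrC.
  have := @two_point_hoeffding (fun c => r * f (set_bit b t c)) r r0 r1.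
  have -> : \sum_c q c * (r * f (set_bit b t c)) = r * bit_mean t f b.
    by rewrite /bit_mean mulr_sumr; apply: eq_bigr => c _; rewrite mulrCA.
  apply; rewrite -mulrBr normrM (ger0_norm r0) ler_piMr //.
  by rewrite -(set_bit_set_bit b t true false); exact: lf.
rewrite /= [_ *+ (size s).+1]mulrS expRD -mulrA ler_wpM2l ?expR_ge0 //.
exact: IH (bit_lipschitz_bit_mean t lf).
Qed.

Lemma cube_mean_bits_mean s f : cube_mean (bits_mean s f) = cube_mean f.
Proof. by elim: s f => // t s IH f; rewrite /= IH cube_mean_bit_mean. Qed.

(** Averaging over all bits turns [f] into the constant [cube_mean f]. *)
Lemma cube_concentration f (r : R) : 0 <= r -> r <= 2^-1 -> bit_lipschitz f ->
  cube_mean (fun b => expR (- (r * f b))) <=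
  expR (- (r * cube_mean f) + 2 * r ^+ 2 *+ #|T|).
Proof.
move=> r0 r1 lf.
have := bits_mean_expR_le (enum T) r0 r1 lf.
rewrite -cardE => /le_trans; apply.
rewrite [leRHS]expRD mulrC ler_wpM2r ?expR_ge0 //.
have cst : forall b, bits_mean (enum T) f b = cube_mean f.
  move=> b; rewrite -[RHS](cube_mean_bits_mean (enum T)).
  rewrite -[LHS]cube_mean_cst; congr cube_mean; apply/funext => b'.
  apply: cube_invariant_cst => u t c; apply: bits_mean_set_bit.
  by left; rewrite mem_enum.
under [fun b => _]eq_fun do rewrite cst.
by rewrite cube_mean_cst.
Qed.

Lemma hamming_set_bit a b t c : (hamming a (set_bit b t c) <= (hamming a b).+1)%N.
Proof.
rewrite /hamming -[X in (_ <= X)%N]add1n -(cards1 t).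
apply: leq_trans (leq_card_setU _ _); apply: subset_leq_card.
apply/fintype.subsetP => u; rewrite !inE ffunE; by case: (u == t).
Qed.

(* [p b] is a nearest point of [A] to [b]; the best choice of the Chernoff
   parameter [r] bounds the mean distance to [A] by O(sqrt (x * #|T|)). *)
Lemma cube_blowup (A : {set {ffun T -> bool}}) (r x : R) :
  0 < r -> r <= 2^-1 -> expR (- x) <= cube_prob A ->
  exists2 p : {ffun T -> bool} -> {ffun T -> bool},
    (forall b, p b \in A) &
    r * cube_mean (fun b => (hamming (p b) b)%:R) <= x + 2 * r ^+ 2 *+ #|T|.
Proof.
move=> r0 r1 pA.
have [a0 a0A] : exists a, a \in A.
  apply/set0Pn/negP => /eqP A0; move: pA.
  by rewrite A0 /cube_prob big_set0 leNgt expR_gt0.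
pose p b := [arg min_(a < a0 in A) hamming a b]%N.
have [pin pmin] : (forall b, p b \in A) /\
    (forall b a, a \in A -> (hamming (p b) b <= hamming a b)%N).
  by split=> b; rewrite /p; case: arg_minnP.
exists p => //.
pose f b : R := (hamming (p b) b)%:R.
have step b t c : f (set_bit b t c) <= f b + 1.
  rewrite /f natr1 ler_nat.
  by apply: leq_trans (pmin _ _ (pin b)) _; exact: hamming_set_bit.
have lf : bit_lipschitz f.
  move=> b t c; rewrite ler_norml; apply/andP; split.
    by have := step b t c; lra.
  by have := step (set_bit b t c) t (b t); rewrite set_bitK; lra.
have := cube_concentration (ltW r0) r1 lf.
(* The distance [f] vanishes on [A], so [A] contributes its whole probability to the exponential
   mean. *)
have : cube_prob A <= cube_mean (fun b => expR (- (r * f b))).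
  apply: cube_prob_le_mean => b; first by rewrite expR_ge0.
  move=> bA; have : (hamming (p b) b <= hamming b b)%N by exact: pmin.
  have -> : hamming b b = 0%N.
    by rewrite /hamming; apply: eq_card0 => t; rewrite inE eqxx.
  by rewrite leqn0 /f => /eqP ->; rewrite mulr0 oppr0 expR0.
move=> /(le_trans pA) /le_trans h /h; rewrite ler_expR /f; lra.
Qed.

End BernoulliCube.

(** * Orthonormal complements *)

Lemma homogeneous_solution (F : fieldType) (C I : finType) (a : C -> I -> F) :
  (#|C| < #|I|)%N ->
  exists2 u : I -> F, (exists i, u i != 0) & forall c, \sum_i a c i * u i = 0.
Proof.
move=> ltCI.
pose A : 'M[F]_(#|I|, #|C|) := \matrix_(i, j) a (enum_val j) (enum_val i).
have : kermx A != 0.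
  rewrite -mxrank_eq0 mxrank_ker -lt0n subn_gt0.
  exact: leq_ltn_trans (rank_leq_col A) ltCI.
case/rowV0Pn => v /sub_kermxP vA v0.
exists (fun i => v 0 (enum_rank i)).
  have /existsP[k vk] : [exists k, v 0 k != 0].
    apply: contraNT v0 => /existsPn v0; apply/eqP/rowP => k.
    by rewrite mxE; apply/eqP/negPn.
  by exists (enum_val k); rewrite enum_valK.
move=> c; have /rowP/(_ (enum_rank c)) := vA.
rewrite !mxE => vAc; rewrite -[RHS]vAc [RHS](reindex enum_rank) /=; last first.
  by apply: onW_bij; exact: enum_rank_bij.
by apply: eq_bigr => i _; rewrite mxE !enum_rankK mulrC.
Qed.

(** Induction on [r]: the next vector is a normalized solution of the equations of orthogonality to
    the [a c] and to the vectors already found, which are fewer than the unknowns. *)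
Lemma orthonormal_complement (R : rcfType) (C I : finType) (a : C -> I -> R)
    (r : nat) : (#|C| + r <= #|I|)%N ->
  exists2 u : 'I_r -> I -> R,
    (forall k c, \sum_i a c i * u k i = 0) &
    (forall k l, \sum_i u k i * u l i = (k == l)%:R).
Proof.
elim: r => [|r IH] Cr; first by exists (fun _ _ => 0) => -[].
have [|u ua uu] := IH; first by apply: leq_trans Cr; rewrite leq_add2l.
pose a' (x : C + 'I_r) := match x with inl c => a c | inr k => u k end.
have [|w [i0 wi0] wa'] := homogeneous_solution a'.
  by rewrite card_sum card_ord -addnS.
have n0 : 0 < \sum_i w i ^+ 2.
  rewrite (bigD1 i0) //= ltr_pwDl ?sumr_ge0 //; last by move=> *; rewrite sqr_ge0.
  by rewrite exprn_even_gt0.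
pose w1 i := w i / Num.sqrt (\sum_i w i ^+ 2).
have w1E (f : I -> R) : \sum_i f i * w i = 0 -> \sum_i f i * w1 i = 0.
  move=> fw; rewrite /w1; under eq_bigr do rewrite mulrA.
  by rewrite -mulr_suml fw mul0r.
exists (fun k => if unlift ord0 k is Some l then u l else w1).
  move=> k c; case: unliftP => [l _|_]; first exact: ua.
  exact: w1E (wa' (inl c)).
move=> k l; case: unliftP => [k' ->|->]; case: unliftP => [l' ->|->].
- by rewrite uu (inj_eq lift_inj).
- by rewrite (w1E _ (wa' (inr k'))).
- by under eq_bigr do rewrite mulrC; rewrite (w1E _ (wa' (inr l'))).
- rewrite eqxx /w1.
  under eq_bigr do rewrite mulrACA -expr2 -invfM -expr2.
  by rewrite -mulr_suml sqr_sqrtr ?(ltW n0) // divff // gt_eqF.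
Qed.

(** Expand the square distance from [z] to its projection onto the span of the [u k]. *)
Lemma bessel (R : realFieldType) (K I : finType) (u : K -> I -> R)
    (z : I -> R) :
  (forall k l, \sum_i u k i * u l i = (k == l)%:R) ->
  \sum_k (\sum_i u k i * z i) ^+ 2 <= \sum_i z i ^+ 2.
Proof.
move=> uu; pose p k := \sum_i u k i * z i.
have pz : \sum_i (\sum_k p k * u k i) * z i = \sum_k p k ^+ 2.
  under eq_bigr do rewrite mulr_suml.
  rewrite exchange_big; apply: eq_bigr => k _ /=.
  rewrite expr2 {3}/p mulr_sumr; apply: eq_bigr => i _.
  by rewrite mulrA.
have pp : \sum_i (\sum_k p k * u k i) ^+ 2 = \sum_k p k ^+ 2.
  transitivity (\sum_k \sum_l p k * p l * \sum_i u k i * u l i).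
    under eq_bigr => i _.
      rewrite expr2 mulr_suml.
      under eq_bigr do rewrite mulr_sumr.
      over.
    rewrite exchange_big; apply: eq_bigr => k _ /=.
    rewrite exchange_big; apply: eq_bigr => l _ /=.
    by rewrite mulr_sumr; apply: eq_bigr => i _; rewrite mulrACA.
  apply: eq_bigr => k _; rewrite (bigD1 k) //= uu eqxx mulr1 big1 ?addr0 //.
  by move=> l lk; rewrite uu eq_sym (negbTE lk) mulr0.
have : 0 <= \sum_i (z i - \sum_k p k * u k i) ^+ 2.
  by apply: sumr_ge0 => i _; rewrite sqr_ge0.
have -> : \sum_i (z i - \sum_k p k * u k i) ^+ 2 =
    \sum_i z i ^+ 2 + (\sum_i (\sum_k p k * u k i) ^+ 2) -
    2 * \sum_i (\sum_k p k * u k i) * z i.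
  rewrite mulr_sumr -big_split -sumrB; apply: eq_bigr => i _ /=; ring.
rewrite pz pp -/p => h; change (\sum_k p k ^+ 2 <= \sum_i z i ^+ 2); lra.
Qed.

(* With weights [expR (- x) ^+ #|J|] the sum over all [J] is
   [(1 + expR (- x)) ^+ #|I|]. *)
Lemma card_small_sets (R : realType) (I : finType) (x y : R) :
  0 <= x ->
  #|[set J : {set I} | #|J|%:R <= y]|%:R <= expR (expR (- x) *+ #|I| + x * y).
Proof.
move=> x0.
have sumE : \sum_(J : {set I}) expR (- x) ^+ #|J| = (1 + expR (- x)) ^+ #|I|.
  rewrite -prodr_const addrC bigA_distr /=.
  apply: eq_big => [J|J _]; first by rewrite ?inE.
  by rewrite -big_mkcond prodr_const.
apply: (@le_trans _ _ (\sum_(J : {set I}) expR (- x) ^+ #|J| * expR (x * y))).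
  rewrite -sum1_card natr_sum big_mkcond /=; apply: ler_sum => J _.
  case: ifPn => [|_]; last by rewrite mulr_ge0 ?exprn_ge0 ?expR_ge0.
  rewrite inE => Jy; rewrite -expRM_natl -expRD -[leLHS]expR0 ler_expR.
  by rewrite mulrN addrC subr_ge0 mulrC ler_wpM2l.
rewrite -mulr_suml sumE expRD ler_wpM2r ?expR_ge0 //.
rewrite -(mulr_natl (expR (- x))) expRM_natl lerXn2r ?nnegrE ?addr_ge0 ?expR_ge0 //.
exact: expR_ge1Dx.
Qed.

(** * Rigidity of local orthonormal systems *)

Section LocalOrthonormalSystem.
Context (R : realType) (T I : finType) (q : bool -> R).
Context (q_ge0 : forall c, 0 <= q c) (q_sum : \sum_c q c = 1).
Context (v : I -> {ffun T -> bool} -> R) (D : I -> {set T}) (B : R) (s : nat).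
Context (v_le : forall i b, `|v i b| <= B).
Context (v_local : forall i (b b' : {ffun T -> bool}),
  {in D i, b =1 b'} -> v i b = v i b').
Context (D_le : forall t, (#|[set i | t \in D i]| <= s)%N).
Context (v_ortho : forall i j,
  cube_mean q (fun b => v i b * v j b) = (i == j)%:R).

(** Each differing bit enters at most [s] coordinates, and a coordinate changes by at most
    [2 * B]. *)
Lemma sum_sqr_diff_le_hamming (b b' : {ffun T -> bool}) :
  \sum_i (v i b - v i b') ^+ 2 <= 4 * B ^+ 2 * s%:R * (hamming b b')%:R.
Proof.
pose S := [set i | v i b != v i b'].
have cardS : (#|S| <= s * hamming b b')%N.
  apply: (@leq_trans #|\bigcup_(t in [set t | b t != b' t]) [set i | t \in D i]|).
    apply: subset_leq_card; apply/fintype.subsetP => i; rewrite inE => neq.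
    apply/bigcupP.
    have /existsP[t /andP[tD bt]] : [exists t, (t \in D i) && (b t != b' t)].
      apply: contraNT neq => /existsPn h; apply/eqP/v_local => t tD.
      by have := h t; rewrite tD negbK => /eqP.
    by exists t; rewrite inE.
  rewrite mulnC -sum_nat_const.
  elim/big_rec2: _ => [|t n A _ An]; first by rewrite cards0.
  by apply: leq_trans (leq_card_setU _ _) _; rewrite leq_add.
apply: (@le_trans _ _ (\sum_(i in S) 4 * B ^+ 2)).
  rewrite [leRHS]big_mkcond; apply: ler_sum => i _; rewrite inE.
  case: eqP => [->|_]; first by rewrite subrr expr0n.
  have := v_le i b; have := v_le i b'; rewrite !ler_norml.
  move: (v i b) (v i b') => x y /andP[? ?] /andP[? ?].
  have : 0 <= (2 * B - (x - y)) * (2 * B + (x - y)) by rewrite mulr_ge0 //; lra.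
  by rewrite /= !expr2; lra.
rewrite sumr_const -[leLHS]mulr_natr -[leRHS]mulrA -natrM ler_wpM2l ?ler_nat //.
by rewrite mulr_ge0 ?sqr_ge0.
Qed.

Lemma mean_sqr_inner (u : I -> R) :
  cube_mean q (fun b => (\sum_i u i * v i b) ^+ 2) = \sum_i u i * u i.
Proof.
transitivity (\sum_i \sum_j cube_mean q (fun b => (u i * u j) * (v i b * v j b))).
  transitivity (cube_mean q (fun b => \sum_i \sum_j (u i * u j) * (v i b * v j b))).
    congr cube_mean; apply/funext => b; rewrite expr2 mulr_suml.
    apply: eq_bigr => i _; rewrite mulr_sumr.
    by apply: eq_bigr => j _; rewrite mulrACA.
  rewrite cube_mean_sum; apply: eq_bigr => i _.
  by rewrite cube_mean_sum.
apply: eq_bigr => i _; rewrite (bigD1 i) //= cube_meanZ v_ortho eqxx mulr1.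
rewrite big1 ?addr0 // => j ji.
by rewrite cube_meanZ v_ortho eq_sym (negbTE ji) mulr0.
Qed.

(* By orthonormality of [v], the left-hand side bounds from below the mean
   square distance from [v] to the span of the [a c] and of the coordinates
   in [J]; the right-hand side bounds it from above, comparing [b] to [p b]. *)
Lemma codim_le_blowup (C : finType) (a : C -> I -> R) (J : {set I}) (tau : R)
    (p : {ffun T -> bool} -> {ffun T -> bool}) : 0 <= tau ->
  (forall b, exists w : C -> R, forall i, i \notin J ->
     `|v i (p b) - \sum_c w c * a c i| <= tau) ->
  #|I|%:R - #|C|%:R - #|J|%:R <=
  8 * B ^+ 2 * s%:R * cube_mean q (fun b => (hamming (p b) b)%:R) +
  2 * tau ^+ 2 * #|I|%:R.
Proof.
move=> tau0 pJ.
(* If [C] and [J] together outnumber [I], the left-hand side is negative; otherwise the natural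
   subtraction defining [n] is exact. *)
have [CJ|ltIC] := leqP (#|C| + #|J|) #|I|; last first.
  apply: (@le_trans _ _ 0).
    by rewrite -addrA -opprD subr_le0 -natrD ler_nat ltnW.
  apply: addr_ge0; apply: mulr_ge0 => //; last by rewrite mulr_ge0 ?sqr_ge0.
    by rewrite mulr_ge0 // mulr_ge0 // sqr_ge0.
  by apply: sumr_ge0 => b _; rewrite mulr_ge0 ?cube_weight_ge0.
pose n := (#|I| - (#|C| + #|J|))%N.
(* Adjoining the unit vectors of [J] forces each [u k] to vanish on [J], where the approximation
   says nothing. *)
pose a' (x : C + {i | i \in J}) (i : I) : R :=
  match x with inl c => a c i | inr j => (i == sval j)%:R end.
have [|u ua uu] := @orthonormal_complement R _ _ a' n.
  by rewrite card_sum card_sig -(@eq_card _ (mem J)) // subnKC.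
have uJ k i : i \in J -> u k i = 0.
  move=> iJ; have := ua k (inr (exist _ i iJ)) => /=.
  rewrite (bigD1 i) //= eqxx mul1r big1 ?addr0 // => j ji.
  by rewrite (negbTE ji) mul0r.
have key b : \sum_k (\sum_i u k i * v i b) ^+ 2 <=
    8 * B ^+ 2 * s%:R * (hamming (p b) b)%:R + 2 * tau ^+ 2 * #|I|%:R.
  have [w wP] := pJ b.
  (* The residual of the approximation at [b], put to 0 on [J]. It pairs with [u k] as [v] does,
     since [u k] kills the [a c] and the coordinates in [J]. *)
  pose z i := if i \in J then 0 else v i b - \sum_c w c * a c i.
  have uz k : \sum_i u k i * v i b = \sum_i u k i * z i.
    have <- : \sum_i u k i * v i b - \sum_i u k i * \sum_c w c * a c i =
              \sum_i u k i * z i.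
      rewrite -sumrB; apply: eq_bigr => i _; rewrite /z.
      by case: ifPn => [/uJ ->|_]; rewrite ?mul0r ?subrr // mulrBr.
    suff -> : \sum_i u k i * \sum_c w c * a c i = 0 by rewrite subr0.
    under eq_bigr do rewrite mulr_sumr.
    rewrite exchange_big big1 //= => c _.
    under eq_bigr do rewrite mulrCA.
    rewrite -mulr_sumr; have := ua k (inl c) => /=.
    under eq_bigr do rewrite mulrC.
    by move=> ->; rewrite mulr0.
  under eq_bigr do rewrite uz.
  apply: (le_trans (bessel z uu)).
  apply: (@le_trans _ _ (\sum_i (2 * (v i (p b) - v i b) ^+ 2 + 2 * tau ^+ 2))).
    apply: ler_sum => i _; rewrite /z; case: ifPn => [_|iJ].
      by rewrite expr0n addr_ge0 // mulr_ge0 ?sqr_ge0.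
    have := wP i iJ; set y := \sum_c _; rewrite ler_norml => /andP[h1 h2].
    have : 0 <= (tau - (v i (p b) - y)) * (tau + (v i (p b) - y)).
      by rewrite mulr_ge0 //; lra.
    have : 0 <= ((v i b - v i (p b)) - (v i (p b) - y)) ^+ 2 by rewrite sqr_ge0.
    by nra.
  rewrite big_split /= sumr_const -[X in _ + X]mulr_natr lerD2r -mulr_sumr.
  have := sum_sqr_diff_le_hamming (p b) b; lra.
(* By orthonormality of [v], each unit vector [u k] contributes mean square 1. *)
have <- : \sum_(k < n) cube_mean q (fun b => (\sum_i u k i * v i b) ^+ 2) =
          #|I|%:R - #|C|%:R - #|J|%:R :> R.
  rewrite -addrA -opprD -natrD -natrB // -/n.
  under eq_bigr do rewrite mean_sqr_inner uu eqxx.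
  by rewrite sumr_const card_ord.
rewrite -cube_mean_sum.
apply: (le_trans (le_cube_mean q_ge0 key)).
by rewrite cube_meanD cube_meanZ cube_mean_cst.
Qed.

End LocalOrthonormalSystem.

Lemma cube_prob_cover (R : realType) (T I : finType) (q : bool -> R)
    (A : {set {ffun T -> bool}}) (S : {set I}) (F : I -> {set {ffun T -> bool}})
    (y : R) :
  (forall c, 0 <= q c) ->
  (forall b, b \in A -> exists2 j, j \in S & b \in F j) ->
  (forall j, j \in S -> cube_prob q (F j) <= y) ->
  cube_prob q A <= #|S|%:R * y.
Proof.
move=> q0 cov Fy; apply: (@le_trans _ _ (\sum_(j in S) cube_prob q (F j))).
  rewrite /cube_prob big_mkcond /=.
  under [leRHS]eq_bigr do rewrite big_mkcond.
  rewrite exchange_big /=; apply: ler_sum => b _.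
  have w0 := cube_weight_ge0 q0 b.
  case: ifPn => [/cov[j jS bF]|_].
    rewrite (bigD1 j) //= bF lerDl sumr_ge0 // => i _; case: ifP => //.
  by apply: sumr_ge0 => i _; case: ifP.
by rewrite mulr_natl -sumr_const; apply: ler_sum.
Qed.

(** [eps] and [eta] depend on [B] and [s] only, so they can be fixed before the finite sets are
    chosen; the coefficients [w] may depend on [b]. *)
Lemma local_orthonormal_rigidity (R : realType) (B : R) (s : nat) :
  exists2 eps : R, 0 < eps & exists2 eta : R, 0 < eta &
  forall (T I C : finType) (q : bool -> R) (v : I -> {ffun T -> bool} -> R)
    (D : I -> {set T}) (a : C -> I -> R) (A : {set {ffun T -> bool}}),
  (forall c, 0 <= q c) -> \sum_c q c = 1 ->
  (forall i b, `|v i b| <= B) ->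
  (forall i (b b' : {ffun T -> bool}), {in D i, b =1 b'} -> v i b = v i b') ->
  (forall t, (#|[set i | t \in D i]| <= s)%N) ->
  (forall i j, cube_mean q (fun b => v i b * v j b) = (i == j)%:R) ->
  (#|T| <= s * #|I|)%N -> (2 * #|C| <= #|I|)%N -> (0 < #|I|)%N ->
  (forall b, b \in A -> exists w : C -> R,
     \sum_i `|v i b - \sum_c w c * a c i| <= eps * #|I|%:R) ->
  cube_prob q A <= 1 - eta.
Proof.
(* [K] and [r] are such that the blow-up term of [codim_le_blowup] is at most
   [K * r * N = N / 16]. *)
pose K : R := 8 * B ^+ 2 * s%:R * (2 * s%:R + 2) + 1.
have Bs0 : 0 <= 8 * B ^+ 2 * s%:R by rewrite mulr_ge0 // mulr_ge0 // sqr_ge0.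
have K1 : 1 <= K by rewrite lerDr mulr_ge0 // addr_ge0 // mulr_ge0.
pose r : R := (16 * K)^-1.
have r0 : 0 < r by rewrite invr_gt0; lra.
have rK : 16 * K * r = 1 by rewrite divff // gt_eqF // -invr_gt0.
have r16 : r <= 16^-1.
  by rewrite /r lef_pV2 ?posrE //; lra.
(* With these values [card_small_sets] allows at most [expR (r ^+ 2 * N)] exceptional sets. Pieces
   of probability below [expR (- (2 * r ^+ 2 * N))] then add up to at most [expR (- r ^+ 2)], which
   is [1 - eta]. *)
pose x : R := 2 / r ^+ 2; pose theta : R := r ^+ 4 / 4.
have x0 : 0 < x by rewrite divr_gt0 ?exprn_gt0.
have theta0 : 0 < theta by rewrite divr_gt0 ?exprn_gt0.
have xtheta : x * theta = r ^+ 2 / 2 by rewrite /x /theta; field; rewrite gt_eqF.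
have ex : expR (- x) <= r ^+ 2 / 2.
  rewrite expRN -[leRHS]invrK lef_pV2 ?posrE ?expR_gt0 //; last first.
    by rewrite invr_gt0 divr_gt0 ?exprn_gt0.
  rewrite invf_div; apply: le_trans (expR_ge1Dx x); rewrite -/x; lra.
have theta4 : theta <= 4^-1.
  have : r ^+ 4 <= 1 by rewrite exprn_ile1 ?(ltW r0) //; lra.
  rewrite /theta; lra.
pose tau : R := 8^-1.
exists (theta * tau); first by rewrite mulr_gt0 // invr_gt0.
exists (1 - expR (- r ^+ 2)).
  by rewrite subr_gt0 expR_lt1 oppr_lt0 exprn_gt0.
move=> T I C q v D a A q0 q1 vB vD Ds vv TI CI I0 Aw.
set N : R := #|I|%:R in Aw *.
have N1 : 1 <= N by rewrite ler1n.
rewrite subKr leNgt; apply/negP => ltA.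
pose F (J : {set I}) : {set {ffun T -> bool}} :=
  [set b in A | `[< exists w : C -> R, forall i, i \notin J ->
     `|v i b - \sum_c w c * a c i| <= tau >]].
pose S := [set J : {set I} | #|J|%:R <= theta * N].
(* Pigeonhole over the exceptional sets of coordinates. *)
have [J JS FJ] : exists2 J, J \in S & expR (- (2 * r ^+ 2 * N)) <= cube_prob q (F J).
  apply: contrapT => noJ.
  have small J : J \in S -> cube_prob q (F J) <= expR (- (2 * r ^+ 2 * N)).
    move=> JS; rewrite leNgt; apply/negP => /ltW h; apply: noJ.
    by exists J.
  have cov b : b \in A -> exists2 J, J \in S & b \in F J.
    move=> bA; have [w wP] := Aw b bA.
    (* By Markov's inequality at most [theta * N] coordinates are off by more than [tau], the total
       error being at most [theta * tau * N]. *)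
    exists [set i | tau < `|v i b - \sum_c w c * a c i|].
      rewrite inE -(@ler_pM2l _ tau) ?invr_gt0 // mulrCA mulrA.
      apply: le_trans wP; rewrite mulr_natr -sumr_const big_mkcond /=.
      apply: ler_sum => i _; rewrite inE; case: ifPn => // /ltW //.
    rewrite inE bA; apply/asboolP; exists w => i.
    by rewrite inE -leNgt.
  have := cube_prob_cover q0 cov small; apply/negP; rewrite -ltNge.
  apply: le_lt_trans (_ : expR (- r ^+ 2) < _) => //.
  apply: (@le_trans _ _ (expR (expR (- x) *+ #|I| + x * (theta * N)) *
                          expR (- (2 * r ^+ 2 * N)))).
    by rewrite ler_wpM2r ?expR_ge0 // card_small_sets // ltW.
  rewrite -expRD ler_expR -mulr_natr -/N mulrA xtheta.
  have : expR (- x) * N <= r ^+ 2 / 2 * N by rewrite ler_wpM2r //; lra.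
  have : r ^+ 2 * 1 <= r ^+ 2 * N by rewrite ler_wpM2l ?sqr_ge0.
  lra.
have r2 : r <= 2^-1 by lra.
have [p pF] := cube_blowup q0 q1 r0 r2 FJ.
set E := cube_mean _ _ => rE.
have E_le : E <= N * (2 * s%:R + 2) * r.
  rewrite -(ler_pM2l r0).
  have : r ^+ 2 * #|T|%:R <= r ^+ 2 * (s%:R * N).
    by rewrite ler_wpM2l ?sqr_ge0 // -natrM ler_nat.
  by move: rE; rewrite -(mulr_natr (2 * r ^+ 2)) expr2; lra.
have tau0 : 0 <= tau by rewrite invr_ge0.
have pJ b : exists w : C -> R, forall i, i \notin J ->
    `|v i (p b) - \sum_c w c * a c i| <= tau.
  by have := pF b; rewrite inE => /andP[_ /asboolP].
(* The left-hand side is at least [N / 4], the right-hand side at most [N / 16 + N / 32]. *)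
have := codim_le_blowup q0 q1 vB vD Ds vv tau0 pJ; rewrite -/E -/N.
have : 8 * B ^+ 2 * s%:R * E <= 8 * B ^+ 2 * s%:R * (N * (2 * s%:R + 2) * r).
  by rewrite ler_wpM2l.
have -> : 8 * B ^+ 2 * s%:R * (N * (2 * s%:R + 2) * r) = N * (K * r) - N * r.
  by rewrite /K; ring.
have -> : K * r = 16^-1 by lra.
have : 0 <= N * r by rewrite mulr_ge0 ?(ltW r0) //; lra.
have : 2 * #|C|%:R <= N by rewrite -natrM ler_nat.
have : #|J|%:R <= theta * N by move: JS; rewrite inE.
have : theta * N <= 4^-1 * N by rewrite ler_wpM2r //; lra.
rewrite /tau; lra.
Qed.

(** * The base space *)

Local Open Scope classical_set_scope.
Local Open Scope ring_scope.

Lemma probability_setC_eq0 (R : realType) d (L : measurableType d)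
    (P : probability L R) (A : set L) :
  measurable A -> P A = 1%E -> P (~` A) = 0%E.
Proof. by move=> mA PA; rewrite probability_setC // PA subee. Qed.

(* Intersecting, for each radius, one full-measure ball of a countable cover
   would leave a single point carrying all the mass. *)
Lemma standard_borel_splits (R : realType) d (L : measurableType d)
    (P : probability L R) : standard_borel R L -> ~ concentrated_on_point P ->
  exists2 A : set L, measurable A & (0 < P A < 1)%E.
Proof.
move=> [T [phi [hT [D cD dD] bij_phi mphi]]] nconc; apply: contrapT => nosplit.
have zero_one (A : set L) : measurable A -> P A = 0%E \/ P A = 1%E.
  move=> mA; have [->|PA0] := eqVneq (P A) 0%E; first by left.
  right; apply: contrapT => PA1; apply: nosplit; exists A => //.
  apply/andP; split; first by rewrite lt_neqAle eq_sym PA0 measure_ge0.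
  by rewrite lt_neqAle probability_le1 // andbT; apply/eqP.
have phiK (B : set T) : phi @` (phi @^-1` B) = B.
  apply: image_preimage; apply/seteqP; split=> // y _.
  by case: bij_phi => g _ gK; exists (g y).
have mopen (B : set T) : open B -> measurable (phi @^-1` B).
  by move=> oB; apply/mphi; rewrite phiK; exact: sub_sigma_algebra.
(* Interiors, because the axioms of [ball] do not make balls open. *)
pose U (x : T) n := (ball x (n.+1%:R^-1 : R))°.
have mU x n : measurable (phi @^-1` U x n) by apply: mopen; exact: open_interior.
have [x0 Dx0] : D !=set0.
  have [y [_ Dy]] := dD setT (ex_intro _ (phi point) I) openT.
  by exists y.
have [g gD] : exists g : nat -> T, D `<=` range g.
  have /pfcard_geP[D0|[f]] := cD; first by rewrite D0 in Dx0.
  by exists f => x Dx; have [n _ <-] := 'surj_f Dx; exists n.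
have full n : exists x, P (phi @^-1` U x n) = 1%E.
  apply: contrapT => none.
  have U0 k : P (phi @^-1` U (g k) n) = 0%E.
    have [//|U1] := zero_one _ (mU (g k) n).
    by exfalso; apply: none; exists (g k).
  have : P (\bigcup_k (phi @^-1` U (g k) n)) = 0%E.
    apply: measure_negligible; first by apply: bigcup_measurable => k _; exact: mU.
    by apply: negligible_bigcup => k; apply/negligibleP => //; exact: U0.
  suff -> : \bigcup_k (phi @^-1` U (g k) n) = setT.
    by rewrite probability_setT => /eqP; rewrite onee_eq0.
  apply/seteqP; split=> // y _.
  have e0 : 0 < n.+1%:R^-1 / 2 :> R by rewrite divr_gt0 ?invr_gt0.
  (* With half the radius, a dense point [x] close to [phi y] has a ball containing a neighbourhood
     of [phi y]. *)
  pose V := (ball (phi y) (n.+1%:R^-1 / 2 : R))°.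
  have Vy : V (phi y) by apply: nbhs_singleton; exact: nbhs_interior (nbhsx_ballx _ _ e0).
  have [x [Vx Dx]] := dD V (ex_intro _ _ Vy) (open_interior _).
  have [k _ gk] := gD _ Dx.
  exists k => //; rewrite /= /U gk.
  apply: filterS (nbhsx_ballx (phi y) _ e0) => z yz.
  rewrite [_^-1]splitr; apply: ball_triangle yz.
  by apply: ball_sym; exact: interior_subset Vx.
pose c n := projT1 (cid (full n)).
have c1 n : P (phi @^-1` U (c n) n) = 1%E by rewrite /c; case: cid.
pose I0 := \bigcap_n (phi @^-1` U (c n) n).
have mI : measurable I0 by apply: bigcap_measurable => //.
have PI : P (~` I0) = 0%E.
  rewrite setC_bigcap; apply: measure_negligible.
    by apply: bigcup_measurable => k _; apply: measurableC; exact: mU.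
  apply: negligible_bigcup => k; apply/negligibleP.
    by apply: measurableC; exact: mU.
  by apply: probability_setC_eq0; [exact: mU|exact: c1].
have [x Ix] : I0 !=set0.
  apply/set0P/eqP => I00; move: PI; rewrite I00 setC0 probability_setT => /eqP.
  by rewrite onee_eq0.
apply: nconc; exists x; suff -> : [set x] = I0 by [].
apply/seteqP; split=> [y ->//|y Iy].
suff /(bij_inj bij_phi) : phi y = phi x by [].
(* Both points lie in the ball of radius [n.+1%:R^-1] about [c n] for all [n]; in a Hausdorff space
   arbitrarily close points coincide. *)
apply: (close_eq hT); rewrite ball_close => e.
have [n ne] : exists n, (n.+1%:R^-1 : R) < e%:num / 2.
  have [n _ /(_ n (leqnn n)) /= h] := near_infty_natSinv_lt (e%:num / 2)%:pos.
  by exists n.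
have Un z : I0 z -> ball (c n) (n.+1%:R^-1) (phi z).
  by move=> /(_ n Logic.I); exact: interior_subset.
rewrite [e%:num]splitr; apply: (@ball_triangle _ _ (c n)).
  by apply: ball_sym; apply: le_ball (Un _ Iy); exact: ltW.
by apply: le_ball (Un _ Ix); exact: ltW.
Qed.

(** * Invariance of the product measure *)

Section BernoulliShift.
Context (R : realType) (Gam : groupType) d (L : measurableType d).
Context (lambda : probability L R) (mu : probability (shift_space Gam L) R).
Context (mu_product : is_product_measure lambda mu).
Local Notation X := (shift_space Gam L).
Local Notation act := (@bernoulli_shift Gam d L).

Lemma bernoulli_shiftM g h (w : X) : act g (act h w) = act (g * h)%g w.
Proof. by apply/funext => x; rewrite /bernoulli_shift invgM mulgA. Qed.

Lemma measurable_coordinate g (A : set L) :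
  measurable A -> measurable ([set w | A (w g)] : set X).
Proof. by move=> mA; apply: sub_sigma_algebra; exists g, A. Qed.

Definition box (F : {fset Gam}) (A : Gam -> set L) : set X :=
  [set w | forall g, g \in F -> A g (w g)].

Lemma measurable_box (F : {fset Gam}) (A : Gam -> set L) :
  (forall g, measurable (A g)) -> measurable (box F A).
Proof.
move=> mA.
have -> : box F A = \bigcap_(g in [set` F]) [set w : X | A g (w g)] by [].
by apply: fin_bigcap_measurable => // g _; exact: measurable_coordinate.
Qed.

Definition boxes : set (set X) :=
  [set C | exists F A, (forall g, measurable (A g)) /\ C = box F A].

Lemma boxes_setI : setI_closed boxes.
Proof.
move=> _ _ [F1 [A1 [mA1 ->]]] [F2 [A2 [mA2 ->]]].
(* Padding by [setT] makes both families of constraints meaningful on the union of the supports. *)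
pose A g := (if g \in F1 then A1 g else setT) `&` (if g \in F2 then A2 g else setT).
exists (F1 `|` F2)%fset, A; split.
  by move=> g; apply: measurableI; case: ifP.
apply/seteqP; split=> w.
  move=> [h1 h2] g _; split; case: ifPn => // gF; [exact: h1|exact: h2].
move=> h; split=> g gF.
  by have [] := h g; rewrite ?inE ?gF.
by have [] := h g; rewrite ?inE ?gF ?orbT.
Qed.

Lemma measurable_boxesE (E : set X) : measurable E -> <<s boxes >> E.
Proof.
apply: smallest_sub; first exact: smallest_sigma_algebra.
move=> _ [g [A [mA ->]]]; apply: sub_sigma_algebra.
exists [fset g]%fset, (fun=> A); split=> //.
apply/seteqP; split=> w /=; first by move=> Aw h; rewrite inE => /eqP ->.
by apply; rewrite inE.
Qed.

Lemma measurable_bernoulli_shift gam : measurable_fun [set: X] (act gam : X -> X).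
Proof.
apply: (@measurability _ _ X X setT (act gam) (@coordinate_sets Gam d L)) =>
  // _ [_ [g [A [mA ->]]] <-].
by rewrite setTI; apply: (@measurable_coordinate (gam^-1 * g)%g).
Qed.

Lemma bernoulli_shift_box gam F A :
  act gam @^-1` box F A =
  box [fset (gam^-1 * g)%g | g in F]%fset (fun g => A (gam * g)%g).
Proof.
apply/seteqP; split=> w h g.
  by move=> /imfsetP[x /= xF ->]; rewrite mulVKg; exact: h.
move=> gF; have := h (gam^-1 * g)%g; rewrite mulVKg; apply.
by apply/imfsetP; exists g.
Qed.

(** Boxes generate and are closed under intersection, so it suffices to compare the measures on
    boxes, where the shift merely reindexes the product. *)
Lemma bernoulli_shift_invariant gam (E : set X) :
  measurable E -> mu (act gam @^-1` E) = mu E.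
Proof.
move=> mE.
pose act' : {mfun X >-> X} := 
  HB.pack (act gam : X -> X)
    (isMeasurableFun.Build _ _ _ _ _ (measurable_bernoulli_shift gam)).
apply: (@g_sigma_algebra_measure_unique _ R X boxes _ (fun=> setT) _ _
  (pushforward mu act') mu) => //.
- by move=> _ [F [A [mA ->]]]; exact: measurable_box.
- move=> _; exists fset0, (fun=> setT); split=> //.
  by apply/seteqP; split.
- by apply/seteqP; split=> // w _; exists 0%N.
- exact: boxes_setI.
- move=> _ [F [A [mA ->]]].
  rewrite -[LHS]/(mu (act gam @^-1` box F A)).
  rewrite bernoulli_shift_box !mu_product //.
  rewrite big_imfset /=; last by move=> x y _ _; exact: mulgI.
  by rewrite mu_product //; apply: eq_bigr => g _; rewrite mulVKg.
- by move=> _; rewrite -[ltLHS]/(mu (act gam @^-1` setT)) preimage_setT probability_setT ltry.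
- exact: measurable_boxesE.
Qed.

Lemma ge0_integral_bernoulli_shift gam (f : X -> \bar R) :
  measurable_fun [set: X] f -> (forall x, 0 <= f x)%E ->
  (\int[mu]_x f (act gam x) = \int[mu]_x f x)%E.
Proof.
move=> mf f0.
have mact := measurable_bernoulli_shift gam.
have := ge0_integral_pushforward mact mu measurableT mf (fun x _ => f0 x).
rewrite preimage_setT => <-.
pose act' : {mfun X >-> X} := 
  HB.pack (act gam : X -> X) (isMeasurableFun.Build _ _ _ _ _ mact).
apply: (@eq_measure_integral _ _ _ _ mu (pushforward mu act')) => E mE _.
by rewrite -[RHS](bernoulli_shift_invariant gam mE).
Qed.

End BernoulliShift.

(** * Finite patterns of independent bits *)

Section BernoulliPatterns.
Context (R : realType) (Gam : groupType) d (L : measurableType d).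
Context (lambda : probability L R) (mu : probability (shift_space Gam L) R).
Context (mu_product : is_product_measure lambda mu).
Context (A : set L) (mA : measurable A).
Local Notation X := (shift_space Gam L).

Definition coin (c : bool) : R := fine (lambda (if c then A else ~` A)).

Lemma measurable_coin_set (c : bool) : measurable (if c then A else ~` A).
Proof. by case: c => //; exact: measurableC. Qed.

Lemma coinE c : (coin c)%:E = lambda (if c then A else ~` A).
Proof. by rewrite fineK // fin_num_measure //; exact: measurable_coin_set. Qed.

Lemma coin_sum : \sum_c coin c = 1.
Proof.
apply: EFin_inj; rewrite big_bool EFinD !coinE probability_setC //.
by rewrite addeC subeK // fin_num_measure.
Qed.

(** Under [mu] these bits are independent with law [coin], which transfers the estimates on finite
    cubes to [X]. *)
Definition pattern (T : {fset Gam}) (w : X) : {ffun T -> bool} :=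
  [ffun t => `[< A (w (val t)) >]].

Lemma pattern_preimageE (T : {fset Gam}) (b : {ffun T -> bool}) :
  [set w | pattern T w = b] =
  box T (fun g => if insub g is Some t then (if b t then A else ~` A) else setT).
Proof.
apply/seteqP; split=> w.
  move=> /= wb g gT; rewrite (insubT (fun g => g \in T) gT) /=.
  by rewrite -wb ffunE /=; case: asboolP.
move=> h; apply/ffunP => t; rewrite ffunE.
have := h (val t) (valP t); rewrite valK.
by case: (b t) => // ?; [exact: asboolT|exact: asboolF].
Qed.

Lemma measurable_pattern (T : {fset Gam}) (b : {ffun T -> bool}) :
  measurable ([set w | pattern T w = b] : set X).
Proof.
rewrite pattern_preimageE; apply: measurable_box => g.
by case: insubP => [t _ _|_]; [exact: measurable_coin_set|exact: measurableT].
Qed.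

Lemma pattern_prob (T : {fset Gam}) (b : {ffun T -> bool}) :
  mu [set w | pattern T w = b] = (cube_weight coin b)%:E.
Proof.
rewrite pattern_preimageE mu_product; last first.
  by move=> g; case: insubP => // t _ _; exact: measurable_coin_set.
rewrite big_seq_fsetE /= /cube_weight -prodEFin.
by apply: eq_bigr => t _; rewrite valK coinE.
Qed.

Lemma comp_patternE (T : {fset Gam}) (f : {ffun T -> bool} -> R) (w : X) :
  f (pattern T w) = \sum_b f b * \1_[set w | pattern T w = b] w.
Proof.
rewrite (bigD1 (pattern T w)) //= indicE mem_set // mulr1 big1 ?addr0 // => b bw.
by rewrite indicE memNset ?mulr0 // => /= wb; rewrite wb eqxx in bw.
Qed.

Lemma measurable_comp_pattern (T : {fset Gam}) (f : {ffun T -> bool} -> R) :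
  measurable_fun setT (fun w : X => f (pattern T w)).
Proof.
have -> : (fun w : X => f (pattern T w)) =
    (fun w => \sum_b f b * \1_[set w | pattern T w = b] w).
  by apply/funext => w; exact: comp_patternE.
apply: measurable_sum => b; apply: measurable_funM => //.
exact: measurable_indic (measurable_pattern b).
Qed.

Lemma integral_comp_pattern (T : {fset Gam}) (f : {ffun T -> bool} -> R) :
  (\int[mu]_w (f (pattern T w))%:E = (cube_mean coin f)%:E)%E.
Proof.
pose g b (w : X) : \bar R := ((f b)%:E * (\1_[set w | pattern T w = b] w)%:E)%E.
have ig b : mu.-integrable [set: X] (fun w => (\1_[set w | pattern T w = b] w)%:E).
  by apply: integrable_indic; exact: measurable_pattern.
transitivity (\int[mu]_w (\sum_b g b w))%E.
  apply: eq_integral => w _; rewrite comp_patternE -sumEFin.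
  by apply: eq_bigr => b _; rewrite EFinM.
rewrite integral_sum //; last by move=> b; apply: integrableZl.
rewrite /cube_mean -sumEFin; apply: eq_bigr => b _.
rewrite integralZl // integral_indic //; last exact: measurable_pattern.
by rewrite setIT mulrC EFinM; congr (_ * _)%E; exact: pattern_prob.
Qed.

(** [G] may depend on coordinates outside [T]; it is only contained in the event that the pattern
    lies in [S]. *)
Lemma le_cube_prob_pattern (T : {fset Gam}) (G : set X)
    (S : {set {ffun T -> bool}}) :
  measurable G -> (forall w, G w -> pattern T w \in S) ->
  (mu G <= (cube_prob coin S)%:E)%E.
Proof.
move=> mG GS.
have -> : cube_prob coin S = cube_mean coin (fun b => (b \in S)%:R).
  rewrite /cube_prob big_mkcond; apply: eq_bigr => b _.
  by case: ifP; rewrite ?mulr1 ?mulr0.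
rewrite -integral_comp_pattern -(setIT G) -integral_indic //.
apply: ge0_le_integral => //.
- apply/measurable_EFinP; exact: measurable_indic.
- apply/measurable_EFinP.
  exact: (@measurable_comp_pattern T (fun b => (b \in S)%:R)).
- move=> w _; rewrite lee_fin indicE; case: (boolP (w \in G)) => // wG.
  by rewrite GS //; rewrite inE in wG.
Qed.

Lemma L1_comp_pattern (T : {fset Gam}) (f : {ffun T -> bool} -> R) :
  L1 mu (fun w : X => (f (pattern T w))%:C%C).
Proof.
split; [exact: measurable_comp_pattern|exact: measurable_cst|].
rewrite /L1norm.
under eq_integral do rewrite /Normc.normc /= expr0n addr0 sqrtr_sqr.
by rewrite (integral_comp_pattern (fun b => `|f b|)) ltry.
Qed.

Lemma L10_comp_pattern (T : {fset Gam}) (f : {ffun T -> bool} -> R) :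
  cube_mean coin f = 0 -> L10 mu (fun w : X => (f (pattern T w))%:C%C).
Proof.
move=> f0; split; first exact: L1_comp_pattern.
rewrite /cintegral /Rintegral /=.
by rewrite integral_comp_pattern f0 integral0.
Qed.

End BernoulliPatterns.

(** * Finite subsets of the group *)

Lemma exists_fresh (T : choiceType) (F : {fset T}) :
  infinite_set [set: T] -> exists x, x \notin F.
Proof.
move=> infT; apply: contrapT => noF; apply: infT.
apply: (@sub_finite_set _ _ [set` F]); last exact: finite_fset.
by move=> x _ /=; apply/negPn/negP => xF; apply: noF; exists x.
Qed.

Lemma exists_fset_card (T : choiceType) (n : nat) :
  infinite_set [set: T] -> exists F : {fset T}, #|` F| = n.
Proof.
move=> infT; elim: n => [|n [F Fn]]; first by exists fset0; rewrite cardfs0.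
have [x xF] := exists_fresh F infT.
by exists (x |` F)%fset; rewrite cardfsU1 xF Fn.
Qed.

(* Adjoining to any [S0] with at least two elements a point outside
   [S0 S0^-1 S0] kills the left stabilizer. *)
Lemma exists_asymmetric_fset (Gam : groupType) (n : nat) :
  infinite_set [set: Gam] ->
  exists2 S : {fset Gam}, #|` S| = n.+3 &
    forall g, (forall x, (x \in S) = ((g * x)%g \in S)) -> g = 1%g.
Proof.
move=> infG; have [S0 S0n] := exists_fset_card n.+2 infG.
have [x xP] := exists_fresh
  [fset (p.1 * p.2^-1 * s)%g | p in S0 `*` S0, s in S0]%fset infG.
have xF s s' s'' : s \in S0 -> s' \in S0 -> s'' \in S0 ->
    x <> (s * s'^-1 * s'')%g.
  move=> sS s'S s''S xE; move/negP: xP; apply.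
  by apply/imfset2P; exists (s, s') => /=; rewrite ?inE ?sS ?s'S //; exists s''.
have xS0 : x \notin S0.
  by apply/negP => xS; apply: (@xF x x x) => //; rewrite mulgV mul1g.
exists (x |` S0)%fset; first by rewrite cardfsU1 xS0 S0n.
move=> g gS; apply: contrapT => g1.
have gxS0 : (g * x)%g \in S0.
  have := gS x; rewrite !inE eqxx /= => /esym /orP[/eqP gx|//].
  by case: g1; apply: (mulIg x); rewrite gx mul1g.
have [s sS0 gsx] : exists2 s, s \in S0 & (g * s)%g != x.
  apply: contrapT => no.
  have gsE s : s \in S0 -> (g * s)%g = x.
    by move=> sS; apply: contrapT => /eqP gs; apply: no; exists s.
  have : (#|` S0| <= #|` [fset (g^-1 * x)%g]%fset|)%N.
    apply: fsubset_leq_card; apply/fsubsetP => s /gsE <-.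
    by rewrite mulKg inE.
  by rewrite S0n cardfs1.
have gsS0 : (g * s)%g \in S0.
  by have := gS s; rewrite !inE sS0 orbT (negbTE gsx) /= => <-.
apply: (xF _ _ _ sS0 gsS0 gxS0).
by rewrite invgM mulVKg mulKg.
Qed.

Lemma leq_card_bigfcup (T : choiceType) (I : Type) (r : seq I)
    (A : I -> {fset T}) :
  (#|` (\bigcup_(i <- r) A i)%fset| <= \sum_(i <- r) #|` A i|)%N.
Proof.
elim/big_rec2: _ => [|i s B _ Bs]; first by rewrite cardfs0.
by apply: leq_trans (leq_card_fsetU _ _) _; rewrite leq_add2l.
Qed.

(** The product set of [K] and [F] is covered by [F] and the symmetric differences of [k F] and [F],
    whose sizes add up to at most that of [F] for a Folner set. *)
Lemma amenable_doubling (R : realType) (Gam : groupType) (K : {fset Gam}) :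
  amenable R Gam ->
  exists2 F : {fset Gam}, F != fset0 &
    (#|` [fset (k * x)%g | k in K, x in F]%fset| <= 2 * #|` F|)%N.
Proof.
move=> [F [F0 Fcvg]].
(* The successor keeps the tolerance positive when [K] is empty. *)
pose e : R := (#|` K|.+1)%:R^-1.
have e0 : 0 < e by rewrite invr_gt0.
pose D k n := (([fset (k * x)%g | x in F n] `\` F n) `|`
               (F n `\` [fset (k * x)%g | x in F n]))%fset.
have small k : \forall n \near \oo, #|` D k n|%:R / #|` F n|%:R < e.
  have /cvgrPdist_lt/(_ e e0) := Fcvg k; apply: filterS => n.
  by rewrite sub0r normrN ger0_norm // divr_ge0.
have [n _ /(_ n (leqnn n)) nP] :
    \forall n \near \oo, forall k, k \in K -> #|` D k n|%:R / #|` F n|%:R < e.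
  exact: (@filter_bigI _ _ K _ _ _ (fun k _ => small k)).
exists (F n) => //; have Fn0 : (0 < #|` F n|)%N by rewrite cardfs_gt0.
have sub : ([fset (k * x)%g | k in K, x in F n] `<=`
            F n `|` \bigcup_(k <- K) D k n)%fset.
  apply/fsubsetP => _ /imfset2P[k kK [x xF ->]]; rewrite inE.
  have [//|kxF] := boolP ((k * x)%g \in F n).
  apply/bigfcupP; exists k; first by rewrite kK.
  by rewrite !inE kxF; apply/orP; left; apply: in_imfset.
apply: leq_trans (fsubset_leq_card sub) _.
apply: leq_trans (leq_card_fsetU _ _) _.
rewrite mul2n -addnn leq_add2l.
apply: (@leq_trans (\sum_(k <- K) #|` D k n|)).
  exact: leq_card_bigfcup.
rewrite -(ler_nat R) natr_sum.
apply: (@le_trans _ _ (\sum_(k <- K) e * #|` F n|%:R)).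
  rewrite big_seq [leRHS]big_seq; apply: ler_sum => k kK.
  by rewrite -ler_pdivrMr ?ltr0n // ltW // nP.
rewrite big_const_seq count_predT iter_addr_0 -[leLHS]mulr_natl mulrA.
rewrite ler_piMl // /e ler_pdivrMr // mul1r ler_nat; exact: leqnSn.
Qed.

(** * Walsh functions and complex-valued measurable functions *)

Lemma exists_standardized (R : rcfType) (q : bool -> R) :
  (forall c, 0 < q c) -> \sum_c q c = 1 ->
  exists2 phi : bool -> R, \sum_c q c * phi c = 0 & \sum_c q c * phi c ^+ 2 = 1.
Proof.
move=> q0; rewrite big_bool /= => q1.
pose v := q true * q false.
have v0 : 0 < v by rewrite mulr_gt0.
(* The centred indicator of [true] over its standard deviation. *)
exists (fun c => (if c then q false else - q true) / Num.sqrt v).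
  by rewrite big_bool /=; ring.
rewrite big_bool /= !expr_div_n sqr_sqrtr ?(ltW v0) //.
have -> : q true * (q false ^+ 2 / v) + q false * ((- q true) ^+ 2 / v) =
  v * (q true + q false) / v by rewrite /v; ring.
by rewrite q1 mulr1 divff // gt_eqF.
Qed.

Section Walsh.
Context (R : realType) (T : finType) (q phi : bool -> R).
Context (q_sum : \sum_c q c = 1) (phi_mean : \sum_c q c * phi c = 0).
Context (phi_var : \sum_c q c * phi c ^+ 2 = 1).

Definition walsh (D : {set T}) (b : {ffun T -> bool}) : R := \prod_(t in D) phi (b t).

Lemma walsh_mean (D : {set T}) : D != finset.set0 -> cube_mean q (walsh D) = 0.
Proof.
case/set0Pn => t tD; rewrite /walsh.
transitivity (cube_mean q (fun b => \prod_t (if t \in D then phi (b t) else 1))).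
  by congr cube_mean; apply/funext => b; rewrite big_mkcond.
rewrite (cube_mean_prod q (fun t c => if t \in D then phi c else 1)).
by rewrite (bigD1 t) //= tD phi_mean mul0r.
Qed.

(** The mean factors over the bits: a bit in both sets gives the variance 1 of [phi], a bit in
    exactly one gives its mean 0. *)
Lemma walsh_ortho (D E : {set T}) :
  cube_mean q (fun b => walsh D b * walsh E b) = (D == E)%:R.
Proof.
pose g t c := (if t \in D then phi c else 1) * (if t \in E then phi c else 1).
transitivity (cube_mean q (fun b => \prod_t g t (b t))).
  congr cube_mean; apply/funext => b; rewrite big_split /=.
  by rewrite /walsh [in LHS]big_mkcond [X in _ * X]big_mkcond.
rewrite cube_mean_prod; have [DE|neq] := eqVneq D E.
  apply: big1 => t _; rewrite /g -?DE; case: (t \in D); first by under eq_bigr do rewrite -expr2.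
  by under eq_bigr do rewrite !mulr1.
have /existsP[t tDE] : [exists t, (t \in D) != (t \in E)].
  apply: contraNT neq => /existsPn h; apply/eqP/setP => t.
  by have := h t; rewrite negbK => /eqP.
rewrite (bigD1 t) //= /g; move: tDE.
case: (t \in D); case: (t \in E) => // _.
  by under eq_bigr do rewrite mulr1; rewrite phi_mean mul0r.
by under eq_bigr do rewrite mul1r; rewrite phi_mean mul0r.
Qed.

Lemma walsh_le (B : R) (n : nat) (D : {set T}) b : 1 <= B ->
  (forall c, `|phi c| <= B) -> (#|D| <= n)%N -> `|walsh D b| <= B ^+ n.
Proof.
move=> B1 phiB Dn; rewrite /walsh normr_prod.
apply: (@le_trans _ _ (B ^+ #|D|)); last by rewrite ler_weXn2l.
by rewrite -prodr_const; apply: ler_prod => t _; rewrite normr_ge0 phiB.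
Qed.

Lemma walsh_local (D : {set T}) (b b' : {ffun T -> bool}) :
  {in D, b =1 b'} -> walsh D b = walsh D b'.
Proof. by move=> bb'; apply: eq_bigr => t tD; rewrite bb'. Qed.

End Walsh.

Lemma complex_Re_sum (R : rcfType) (I : Type) (s : seq I) (P : pred I) (f : I -> R[i]) :
  complex.Re (\sum_(i <- s | P i) f i) = \sum_(i <- s | P i) complex.Re (f i).
Proof. by apply: big_morph => [[a b] [c e]|]. Qed.

Lemma complex_Im_sum (R : rcfType) (I : Type) (s : seq I) (P : pred I) (f : I -> R[i]) :
  complex.Im (\sum_(i <- s | P i) f i) = \sum_(i <- s | P i) complex.Im (f i).
Proof. by apply: big_morph => [[a b] [c e]|]. Qed.

Lemma complex_ReM (R : rcfType) (x y : R[i]) :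
  complex.Re (x * y) =
  complex.Re x * complex.Re y - complex.Im x * complex.Im y.
Proof. by case: x y => a b [c e]. Qed.

Lemma complex_ImM (R : rcfType) (x y : R[i]) :
  complex.Im (x * y) =
  complex.Re x * complex.Im y + complex.Im x * complex.Re y.
Proof. by case: x y => a b [c e]. Qed.

Lemma ler_Re_normc (R : rcfType) (x : R[i]) : `|complex.Re x| <= Normc.normc x.
Proof.
by case: x => a b /=; rewrite -sqrtr_sqr ler_wsqrtr // lerDl sqr_ge0.
Qed.

Lemma normc_ge0 (R : rcfType) (x : R[i]) : 0 <= Normc.normc x.
Proof. by case: x => a b; rewrite /Normc.normc sqrtr_ge0. Qed.

Section ComplexMeasurable.
Context (R : realType) d (X : measurableType d).

Definition cmeasurable (f : X -> R[i]) :=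
  measurable_fun setT (fun x => complex.Re (f x)) /\
  measurable_fun setT (fun x => complex.Im (f x)).

Lemma cmeasurableB f g :
  cmeasurable f -> cmeasurable g -> cmeasurable (fun x => f x - g x).
Proof.
move=> [fr fi] [gr gi]; split.
  rewrite (_ : (fun x => _) = (fun x => complex.Re (f x) - complex.Re (g x))).
    exact: measurable_funB.
  by apply/funext => x; case: (f x) (g x) => ? ? [].
rewrite (_ : (fun x => _) = (fun x => complex.Im (f x) - complex.Im (g x))).
  exact: measurable_funB.
by apply/funext => x; case: (f x) (g x) => ? ? [].
Qed.

Lemma cmeasurable_lincomb (I : Type) (s : seq I) (c : I -> R[i])
    (f : I -> X -> R[i]) : (forall i, cmeasurable (f i)) ->
  cmeasurable (fun x => \sum_(i <- s) c i * f i x).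
Proof.
move=> mf; split.
  under eq_fun do rewrite complex_Re_sum.
  apply: measurable_sum => i; under eq_fun do rewrite complex_ReM.
  have [mr mi] := mf i.
  by apply: measurable_funB; apply: measurable_funM.
under eq_fun do rewrite complex_Im_sum.
apply: measurable_sum => i; under eq_fun do rewrite complex_ImM.
have [mr mi] := mf i.
by apply: measurable_funD; apply: measurable_funM.
Qed.

Lemma measurable_normc f :
  cmeasurable f -> measurable_fun setT (fun x => Normc.normc (f x)).
Proof.
move=> [fr fi].
rewrite (_ : (fun x => _) = (fun x => Num.sqrt (complex.Re (f x) ^+ 2 + complex.Im (f x) ^+ 2))).
  apply: (measurableT_comp (continuous_measurable_fun (@sqrt_continuous R))).
  by apply: measurable_funD; apply: measurable_funX.
by apply/funext => x; case: (f x).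
Qed.

End ComplexMeasurable.

Lemma cmeasurable_comp (R : realType) d d' (X : measurableType d)
    (Y : measurableType d') (f : X -> R[i]) (g : Y -> X) :
  cmeasurable f -> measurable_fun setT g -> cmeasurable (fun y => f (g y)).
Proof.
move=> [mr mi] mg; split.
  exact: (measurableT_comp mr mg).
exact: (measurableT_comp mi mg).
Qed.

(** * Translates and orbit combinations *)

Section Translates.
Context (Gam : groupType).
Implicit Types (S T : {fset Gam}) (a g : Gam).

(** The set [a^-1 S], cut down to [T] and viewed as a set of bits. *)
Definition translate T S a : {set T} := [set t : T | (a * val t)%g \in S].

Lemma card_preimage_fset T S (h : Gam -> Gam) : injective h ->
  (#|[set t : T | h (val t) \in S]%SET| <= #|` S|)%N.
Proof.
move=> h_inj.
have -> : #|[set t : T | h (val t) \in S]%SET| =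
          #|` [fset x in T | h x \in S]%fset|.
  rewrite card_fset_sum1 big_fset /= big_seq_fsetE -sum1_card.
  by apply: eq_bigl => t; rewrite inE.
have <- : #|` [fset h x | x in [fset x in T | h x \in S]]%fset| =
          #|` [fset x in T | h x \in S]%fset| by exact: card_imfset.
apply: fsubset_leq_card; apply/fsubsetP => _ /imfsetP[x /= xS ->].
by move: xS; rewrite !inE => /andP[].
Qed.

(** [T] contains both translates entirely, so agreement inside [T] is agreement in the group. *)
Lemma translate_eq T S S' a a' :
  (forall g, g \in S -> (a^-1 * g)%g \in T) ->
  (forall g, g \in S' -> (a'^-1 * g)%g \in T) ->
  translate T S a = translate T S' a' ->
  forall g, ((a * g)%g \in S) = ((a' * g)%g \in S').
Proof.
move=> ST ST' /setP eqT g.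
have [gT|gT] := boolP (g \in T).
  by have := eqT [` gT]%fset; rewrite !inE.
apply/idP/idP => h; case/negP: gT.
  by rewrite -(mulKg a g); exact: ST.
by rewrite -(mulKg a' g); exact: ST'.
Qed.

Lemma translate_eq_card T S S' a a' :
  (forall g, g \in S -> (a^-1 * g)%g \in T) ->
  (forall g, g \in S' -> (a'^-1 * g)%g \in T) ->
  translate T S a = translate T S' a' -> #|` S| = #|` S'|.
Proof.
move=> ST ST' /(translate_eq ST ST') eqS.
transitivity #|` [fset (a' * (a^-1 * x))%g | x in S]%fset|.
  by apply/esym; apply: card_imfset => x y /mulgI /mulgI.
congr (#|` _|); apply/fsetP => x; apply/imfsetP/idP => [[y /= yS ->]|xS].
  by rewrite -eqS mulVKg.
exists (a * (a'^-1 * x))%g => /=; first by rewrite eqS mulVKg.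
by rewrite mulKg mulVKg.
Qed.

(** If the translates agree, then [a' * a^-1] stabilizes [S]. *)
Lemma translate_inj T S a a' :
  (forall g, (forall x, (x \in S) = ((g * x)%g \in S)) -> g = 1%g) ->
  (forall g, g \in S -> (a^-1 * g)%g \in T) ->
  (forall g, g \in S -> (a'^-1 * g)%g \in T) ->
  translate T S a = translate T S a' -> a = a'.
Proof.
move=> asym ST ST' /(translate_eq ST ST') eqS.
have /(congr1 (fun x => x * a)%g) : (a' * a^-1)%g = 1%g.
  by apply: asym => x; rewrite -mulgA -eqS mulVKg.
by rewrite mulgVK mul1g.
Qed.

(** The bits of the shifted point on [S] are those of [w] on [a^-1 S]. *)
Lemma walsh_translate (R : realType) d (L : measurableType d) (A : set L)
    (phi : bool -> R) T S a (w : shift_space Gam L) :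
  (forall g, g \in S -> (a^-1 * g)%g \in T) ->
  walsh phi (translate T S a) (pattern A T w) =
  walsh phi finset.setT (pattern A S (bernoulli_shift a w)).
Proof.
move=> ST; rewrite /walsh.
pose F x := phi `[< A (w x) >].
transitivity (\prod_(x <- [fset x in T | (a * x)%g \in S]%fset) F x).
  rewrite big_fset /= big_seq_fsetE.
  by apply: eq_big => t; rewrite ?inE // => _; rewrite ffunE.
transitivity (\prod_(x <- [fset (a^-1 * g)%g | g in S]%fset) F x).
  apply: eq_fbigl => x; rewrite !inE.
  apply/andP/imfsetP => [[_ axS]|[g /= gS ->]].
    by exists (a * x)%g => //; rewrite mulKg.
  by rewrite mulVKg; split=> //; exact: ST.
rewrite big_imfset /=; last by move=> x y _ _; exact: mulgI.
rewrite big_seq_fsetE /=.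
by apply: eq_big => t; rewrite ?inE // => _; rewrite ffunE.
Qed.

End Translates.

Section OrbitCoordinates.
Context (R : realType) (Gam : groupType) d (X : measurableType d).
Context (act : Gam -> X -> X).
Context (actM : forall g h x, act g (act h x) = act (g * h)%g x).
Context (m : nat) (f : 'I_m -> X -> R[i]) (U : {fset Gam}).
Implicit Types (s : seq (R[i] * Gam * 'I_m)) (a : Gam) (c : U * 'I_m * bool).

(** Since [Re (c z) = Re c * Re z - Im c * Im z], each complex value of a generator at a translate
    gives two real unknowns; the flag [true] marks the imaginary part. *)
Definition orbit_coef s a c : R :=
  \sum_(t <- s | ((t.1.2)^-1 * a == val c.1.1)%g && (t.2 == c.1.2))
     (if c.2 then - complex.Im t.1.1 else complex.Re t.1.1).

Definition orbit_value (x : X) c : R :=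
  if c.2 then complex.Im (f c.1.2 (act (val c.1.1) x))
  else complex.Re (f c.1.2 (act (val c.1.1) x)).

(** The coefficients do not involve [x]. Hence, as functions of the pair [(s, a)], the real parts
    lie for every [x] in one real space of dimension at most [2 m |U|]. *)
Lemma Re_orbit_combination s a x :
  (forall t, t \in s -> ((t.1.2)^-1 * a)%g \in U) ->
  complex.Re (\sum_(t <- s) t.1.1 * koopman act t.1.2 (f t.2) (act a x)) =
  \sum_c orbit_value x c * orbit_coef s a c.
Proof.
move=> sU; rewrite complex_Re_sum.
under [RHS]eq_bigr do rewrite /orbit_coef mulr_sumr big_mkcond.
rewrite exchange_big /= big_seq [RHS]big_seq; apply: eq_bigr => t ts.
pose u : U := [` sU t ts]%fset.
rewrite -(pair_bigA _ (fun p b =>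
  if ((t.1.2)^-1 * a == val p.1)%g && (t.2 == p.2) then
    orbit_value x (p, b) * (if b then - complex.Im t.1.1 else complex.Re t.1.1)
  else 0)) /=.
rewrite (bigD1 (u, t.2)) //= [X in _ + X]big1 ?addr0.
  rewrite !eqxx /= big_bool /orbit_value /= /koopman actM complex_ReM; ring.
move=> [u' s'] neq /=; apply: big1 => b _; case: ifPn => // /andP[/eqP e1 /eqP e2].
case/eqP: neq; rewrite -e2; congr pair; apply: val_inj; exact: esym.
Qed.

End OrbitCoordinates.

(** * Multiplicity *)

Lemma ge0_markov (R : realType) d (X : measurableType d) (mu : probability X R)
    (Z : X -> R) (y M : R) : measurable_fun setT Z -> (forall x, 0 <= Z x) ->
  0 < y -> (\int[mu]_x (Z x)%:E <= M%:E)%E ->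
  ((1 - M / y)%:E <= mu [set x | (Z x < y)%R])%E.
Proof.
move=> mZ Z0 y0 ZM.
pose G := [set x | y <= Z x].
have mG : measurable G.
  rewrite (_ : G = setT `&` Z @^-1` `[y, +oo[%classic); first exact: mZ.
  by rewrite setTI; apply/seteqP; split=> x /=; rewrite in_itv /= andbT.
have -> : [set x | Z x < y] = ~` G.
  by apply/seteqP; split=> x /=; rewrite /G /= ltNge => /negP.
rewrite probability_setC //.
have Gfin : mu G \is a fin_num by exact: fin_num_measure.
rewrite -(fineK Gfin) -EFinB lee_fin lerD2l lerN2 ler_pdivlMr //.
rewrite -lee_fin EFinM fineK // muleC.
apply: le_trans ZM.
have mZ' : measurable_fun setT (EFin \o Z) by apply/measurable_EFinP.
have -> : G = setT `&` [set x | (y%:E <= `|(EFin \o Z) x|)%E].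
  by rewrite setTI; apply/seteqP; split=> x /=; rewrite lee_fin ger0_norm.
apply: le_trans (le_integral_abse mu measurableT mZ' y0) _.
by under eq_integral do rewrite /= ger0_norm //.
Qed.

(** * Impossibility of finite generation *)

Section NoFiniteGeneration.
Context (R : realType) (Gam : groupType) d (L : measurableType d).
Context (lambda : probability L R) (mu : probability (shift_space Gam L) R).
Context (mu_product : is_product_measure lambda mu).
Context (Gam_infinite : infinite_set [set: Gam]) (Gam_amenable : amenable R Gam).
Context (A : set L) (mA : measurable A) (A01 : (0 < lambda A < 1)%E).
Local Notation X := (shift_space Gam L).
Local Notation act := (@bernoulli_shift Gam d L).
Local Notation q := (coin lambda A).

Lemma coin_gt0 c : 0 < q c.
Proof.
case/andP: A01 => A0 A1; rewrite -lte_fin coinE //; case: c => //.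
by rewrite probability_setC // sube_gt0.
Qed.

Lemma cmeasurable_orbit_span m (f : 'I_m -> X -> R[i]) h :
  (forall s, L1 mu (f s)) -> orbit_span act f h -> cmeasurable h.
Proof.
move=> fL1 [sq ->]; apply: cmeasurable_lincomb => t.
have mf : cmeasurable (f t.2) by have [] := fL1 t.2.
exact: (cmeasurable_comp mf (measurable_bernoulli_shift (t.1.2)^-1)).
Qed.

(** By invariance every shifted error has mean at most [delta]; Markov's inequality is applied to
    their sum. *)
Lemma shift_approximation_prob (I : finType) (a : I -> Gam) (E : I -> X -> R)
    (delta y : R) : (forall l, measurable_fun setT (E l)) ->
  (forall l x, 0 <= E l x) ->
  (forall l, \int[mu]_x (E l x)%:E <= delta%:E)%E -> 0 < y ->
  ((1 - delta * #|I|%:R / y)%:E <= mu [set x | (\sum_l E l (act (a l) x) < y)%R])%E.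
Proof.
move=> mE E0 Ed y0.
have mEa l : measurable_fun setT (fun x => E l (act (a l) x)).
  exact: (measurableT_comp (mE l) (measurable_bernoulli_shift (a l))).
apply: ge0_markov => //.
- by apply: measurable_sum.
- by move=> x; apply: sumr_ge0.
under eq_integral do rewrite -sumEFin.
rewrite ge0_integral_sum //; last 2 first.
- by move=> l; apply/measurable_EFinP.
- by move=> l x _; rewrite lee_fin.
apply: (@le_trans _ _ (\sum_(l : I) delta%:E)%E).
  apply: lee_sum => l _.
  have mEl : measurable_fun setT (EFin \o E l) by apply/measurable_EFinP.
  rewrite (ge0_integral_bernoulli_shift mu_product (a l) mEl); first exact: Ed.
  by move=> x; rewrite lee_fin.
by rewrite sumEFin sumr_const mulr_natr.
Qed.

(** Only centred functions of finitely many bits have to be approximated, which serves [L1] and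
    [L10] alike. *)
Lemma no_finite_generation m (f : 'I_m -> X -> R[i]) :
  (0 < m)%N -> (forall s, L1 mu (f s)) ->
  (forall (T : {fset Gam}) (g : {ffun T -> bool} -> R), cube_mean q g = 0 ->
     closed_orbit_span mu act f (fun w => (g (pattern A T w))%:C%C)) -> False.
Proof.
move=> m0 fL1 gen.
have [phi ph1 ph2] := exists_standardized coin_gt0 (coin_sum lambda mA).
have q1 := coin_sum lambda mA.
(* The real space has dimension [2 m |U|] with [|U| <= 2 |F|], at most half of the [8 m |F|] members
   of the system. *)
pose k := (8 * m)%N.
have asym n : exists S : {fset Gam}, #|` S| = n.+3 /\
    forall g, (forall x, (x \in S) = ((g * x)%g \in S)) -> g = 1%g.
  by have [S0 S0n ?] := exists_asymmetric_fset n Gam_infinite; exists S0.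
have [S SP] := boolp.choice asym.
have Scard n : #|` S n| = n.+3 by have [] := SP n.
(* Bounds the number of pairs [(a, j)] for which a given bit lies in [a^-1 S_j], and also
   [|T| / |F|]. *)
pose s := (\sum_(j < k) #|` S j|)%N.
pose B0 : R := 1 + `|phi true| + `|phi false|.
have B01 : 1 <= B0 by rewrite /B0 -addrA lerDl addr_ge0.
have phiB c : `|phi c| <= B0.
  by rewrite /B0; have := normr_ge0 (phi true); have := normr_ge0 (phi false); case: c; lra.
have [eps eps0 [eta eta0 rig]] := local_orthonormal_rigidity (B0 ^+ (k + 3)) s.
(* Markov's inequality at level [eps * #|I|%:R] then fails with probability at most
   [delta / eps = eta / 2]. *)
pose delta := eps * eta / 2.
have delta0 : 0 < delta by rewrite divr_gt0 // mulr_gt0.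
pose h (j : 'I_k) (w : X) : R[i] :=
  (walsh phi finset.setT (pattern A (S j) w))%:C%C.
pose comb (sq : seq (R[i] * Gam * 'I_m)) (w : X) : R[i] :=
  \sum_(t <- sq) t.1.1 * koopman act t.1.2 (f t.2) w.
have approx (j : 'I_k) : exists sq,
    (L1norm mu (fun w => (h j w - comb sq w)%R) < delta%:E)%E.
  have hm : cube_mean q (walsh phi [set: S j]%SET) = 0.
    apply: walsh_mean => //; rewrite -card_gt0 cardsT.
    by rewrite -cardfE Scard.
  have [_ /(_ _ delta0)[_ [sq ->] sqP]] := gen _ _ hm.
  by exists sq.
have [sq sqP] := boolp.choice approx.
(* Inverses, since the Koopman operator of [g] evaluates at the translate by [g^-1]. *)
pose K : {fset Gam} := [fset x in flatten
  [seq [seq (t.1.2^-1)%g | t <- sq j] | j <- enum 'I_k]]%fset.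
have KP j t : t \in sq j -> (t.1.2^-1)%g \in K.
  move=> tj; rewrite inE; apply/flattenP.
  exists [seq (t.1.2^-1)%g | t <- sq j]; last by apply: map_f.
  by apply: map_f; rewrite mem_enum.
have [F F0 Fdbl] := amenable_doubling K Gam_amenable.
pose U := [fset (x * a)%g | x in K, a in F]%fset.
pose I : finType := (F * 'I_k)%type.
pose T : {fset Gam} :=
  (\bigcup_(l <- enum I) [fset ((val l.1)^-1 * g)%g | g in S l.2])%fset.
have inT (l : I) g : g \in S l.2 -> ((val l.1)^-1 * g)%g \in T.
  move=> gS; apply/bigfcupP; exists l; first by rewrite mem_enum.
  by apply/imfsetP; exists g.
have cardI : #|I| = (#|` F| * k)%N by rewrite card_prod card_ord cardfE.
have k0 : (0 < k)%N by rewrite muln_gt0.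
have I0 : (0 < #|I|)%N by rewrite cardI muln_gt0 k0 cardfs_gt0 F0.
pose D (l : I) : {set T} := translate T (S l.2) (val l.1).
pose v (l : I) := walsh phi (D l).
pose C : finType := (U * 'I_m * bool)%type.
pose a (c : C) (l : I) : R := orbit_coef (sq l.2) (val l.1) c.
(* Quantifying over the weights makes closeness a condition on the pattern alone, although the
   generators depend on all coordinates. *)
pose A' : {set {ffun T -> bool}} := [set b | `[< exists w : C -> R,
  \sum_l `|v l b - \sum_c w c * a c l| <= eps * #|I|%:R >]]%SET.
(* For fixed [j], the element [x] is determined by the member [x * t] of [S j]. *)
have Dle (t : T) : (#|[set l | t \in D l]%SET| <= s)%N.
  pose Q (j : 'I_k) := [set x : F | (val x * val t)%g \in S j]%SET.
  apply: (@leq_trans (\sum_(j < k) #|Q j|)%N); last first.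
    apply: leq_sum => j _.
    exact: (@card_preimage_fset _ F (S j) (fun x => (x * val t)%g) (mulIg _)).
  have -> : #|[set l | t \in D l]%SET| =
      (\sum_(x : F) \sum_(j < k) ((val x * val t)%g \in S j))%N.
    rewrite pair_bigA -sum1_card big_mkcond /=; apply: eq_bigr => l _.
    by rewrite !inE; case: ifP.
  rewrite exchange_big /=; apply/eq_leq/eq_bigr => j _.
  rewrite -sum1_card [RHS]big_mkcond; apply: eq_bigr => x _.
  by rewrite !inE; case: ifP.
have Tcard : (#|T : finType| <= s * #|I|)%N.
  rewrite -cardfE; apply: leq_trans (leq_card_bigfcup _ _) _; rewrite big_enum /=.
  apply: (@leq_trans (\sum_(l : I) #|` S l.2|)%N).
    by apply: leq_sum => l _; exact: leq_imfset_card.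
  rewrite -(pair_bigA _ (fun (x : F) (j : 'I_k) => #|` S j|)) /= sum_nat_const -/s.
  by rewrite mulnC leq_mul2l cardI cardfE leq_pmulr ?orbT.
have Ccard : (2 * #|C| <= #|I|)%N.
  have CE : #|C| = (#|` U| * m * 2)%N.
    by rewrite !card_prod card_ord card_bool cardfE.
  rewrite CE cardI /k.
  by move: Fdbl; rewrite -/U; nia.
(* Cardinality recovers the index [j], asymmetry of [S j] the translating element. *)
have D_inj : injective D.
  move=> [x j] [y i] Deq.
  have xT g : g \in S j -> ((val x)^-1 * g)%g \in T by apply: (inT (x, j)).
  have yT g : g \in S i -> ((val y)^-1 * g)%g \in T by apply: (inT (y, i)).
  have /eqP := translate_eq_card xT yT Deq; rewrite !Scard !eqSS => /eqP ji.
  have {}ji := val_inj ji; rewrite -ji in yT Deq *.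
  congr pair; apply: val_inj; apply: (translate_inj _ xT yT Deq).
  by have [] := SP j.
have probA' : cube_prob q A' <= 1 - eta.
  apply: (rig T I C q v D a A') => //.
  - by move=> c; exact: ltW (coin_gt0 c).
  - move=> l b; apply: walsh_le => //.
    apply: leq_trans (@card_preimage_fset _ T (S l.2) _ (mulgI (val l.1))) _.
    by rewrite Scard addn3 !ltnS ltnW.
  - by move=> l b b'; exact: walsh_local.
  - by move=> l l'; rewrite /v walsh_ortho // (inj_eq D_inj).
  - by move=> b; rewrite inE => /asboolP.
pose E (l : I) (w : X) := Normc.normc (h l.2 w - comb (sq l.2) w).
have mh j : cmeasurable (h j).
  by have [] := L1_comp_pattern mu_product mA (walsh phi [set: S j]%SET).
have mcomb j : cmeasurable (comb (sq j)).
  by apply: (cmeasurable_orbit_span fL1); exists (sq j).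
have mE l : measurable_fun setT (E l).
  by apply: measurable_normc; exact: cmeasurableB.
have y0 : 0 < eps * #|I|%:R :> R by rewrite mulr_gt0 // ltr0n.
(* The approximation event has probability at least [1 - eta / 2], against the bound [1 - eta] from
   rigidity. *)
have := shift_approximation_prob (fun l : I => val l.1) mE
  (fun l w => normc_ge0 _) (fun l => ltW (sqP l.2)) y0.
set G := [set x | _]; rewrite leNgt => /negP; apply.
have mG : measurable G.
  have mS : measurable_fun setT (fun w => \sum_l E l (act (val l.1) w)).
    apply: measurable_sum => l.
    exact: (measurableT_comp (mE l) (measurable_bernoulli_shift (val l.1))).
  rewrite (_ : G = setT `&` (fun w => \sum_l E l (act (val l.1) w)) @^-1`
    `]-oo, (eps * #|I|%:R)[%classic); first exact: mS.
  by rewrite setTI; apply/seteqP; split=> w /=; rewrite in_itv.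
(* The values of the generators along the orbit of [w] serve as weights, and taking real parts does
   not increase the error. *)
have GA' w : G w -> pattern A T w \in A'.
  move=> Gw; rewrite inE; apply/asboolP; exists (orbit_value act f w).
  apply: le_trans (ltW Gw); apply: ler_sum => l _.
  rewrite -(Re_orbit_combination (@bernoulli_shiftM Gam d L)).
    rewrite /v /D walsh_translate; last exact: inT.
    have := ler_Re_normc
      (h l.2 (act (val l.1) w) - comb (sq l.2) (act (val l.1) w)).
    by rewrite raddfB.
  move=> t tsq; apply/imfset2P; exists (t.1.2^-1)%g; first exact: KP tsq.
  by exists (val l.1) => //; exact: valP.
apply: le_lt_trans (le_cube_prob_pattern mu_product mA mG GA') _.
rewrite lte_fin; apply: le_lt_trans probA' _.
have -> : delta * #|I|%:R / (eps * #|I|%:R) = eta / 2.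
  by rewrite /delta; field; rewrite !gt_eqF ?ltr0n.
lra.
Qed.

End NoFiniteGeneration.

Lemma orbit_mult_eqy (R : realType) d (X : measurableType d)
    (mu : probability X R) (Gam : groupType) (act : Gam -> X -> X)
    (V : set (X -> R[i])) :
  (forall m (f : 'I_m -> X -> R[i]), (0 < m)%N -> (forall s, V (f s)) ->
     closed_orbit_span mu act f <> V) ->
  orbit_mult mu act V = +oo%E.
Proof.
move=> noV; rewrite /orbit_mult.
rewrite [X in ereal_inf X](_ : _ = set0) ?ereal_inf0 //.
apply/seteqP; split=> // y [m [m0 [f [Vf fV]]] _].
exact: noV m0 Vf fV.
Qed.

Theorem corollary4p2 (R : realType) (Gam : groupType)
    (d : measure_display) (L : measurableType d)
    (lambda : probability L R) (mu : probability (shift_space Gam L) R)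
    (Gam_countable : countable [set: Gam])
    (Gam_infinite : infinite_set [set: Gam])
    (Gam_amenable : amenable R Gam)
    (L_standard : standard_borel R L)
    (lambda_nontrivial : ~ concentrated_on_point lambda)
    (mu_product : is_product_measure lambda mu) :
  mult_L1 mu (@bernoulli_shift Gam d L) = +oo%E /\
  mult_L10 mu (@bernoulli_shift Gam d L) = +oo%E.
Proof.
have [A mA A01] := standard_borel_splits L_standard lambda_nontrivial.
(* Both multiplicities are instances of a space [V] lying between [L10] and [L1]. *)
have infinite_mult V : V `<=` L1 mu -> L10 mu `<=` V ->
    orbit_mult mu (@bernoulli_shift Gam d L) V = +oo%E.
  move=> VL1 L10V; apply: orbit_mult_eqy => m f m0 Vf fV.
  apply: (no_finite_generation mu_product Gam_infinite Gam_amenable mA A01 m0 (f := f)).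
    by move=> s; exact: VL1.
  move=> T g g0; rewrite fV; apply: L10V.
  exact: (L10_comp_pattern mu_product mA).
split; apply: infinite_mult => //.
  by move=> f [].
by move=> f [].
Qed.
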